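(* Let $\delta \in (0,1)$ be a constant. Any data structure (in the word RAM / cell-probe model with word size $\Theta(\log n)$) that stores a string of length $n$ over the alphabet $\{0,\ldots,\sigma-1\}$ with $r$ runs in $O(r\log^{O(1)} n)$ bits requires, in the worst case, $\Omega(\log\frac{\log(n\sigma/r)}{\log\log n})$ time for $\mathsf{rank}_c$ queries and $\Omega(\log\frac{\log(n/r)}{\log\log n})$ time for $\mathsf{select}_c$ and $\mathsf{access}$ queries, provided $r \ge 2^{\log^\delta n}$.
   Context: All logarithms are base 2. A run in a string is a maximal substring in which all letters are equal; $r$ is the number of such runs. For a string $B$: $\mathsf{access}(i,B)$ returns $B[i]$; $\mathsf{rank}_c(i,B)$ returns the number of occurrences of $c$ in $B[0..i]$; $\mathsf{select}_c(i,B)$ returns the position of the $i$-th occurrence of $c$ in $B$, or $-1$ if $i<1$ or there are fewer than $i$ occurrences. *)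

(* Defs.v *)
From HB Require Import structures.
From mathcomp Require Import all_boot all_order all_algebra.
From mathcomp Require Import reals exp.

Set Implicit Arguments.
Unset Strict Implicit.
Unset Printing Implicit Defensive.
Import Order.TTheory GRing.Theory Num.Theory.

(* Total functions: [log2 x = 0] for [x <= 0], inherited from [ln]. *)
Definition log2 (R : realType) (x : R) : R := (ln x / ln 2)%R.

Section Strings.
Variables n sigma : nat.
Implicit Types (B : n.-tuple 'I_sigma) (c : 'I_sigma).

(* A pair [(i, j)] of positions with [i <= j] stands for the nonempty
   substring occurrence B[i..j], both ends included. *)
Definition unary B (p : 'I_n * 'I_n) : bool :=
  (p.1 <= p.2) &&
  [forall k : 'I_n, (p.1 <= k <= p.2) ==> (tnth B k == tnth B p.1)].

Definition is_run B (p : 'I_n * 'I_n) : bool :=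
  unary B p &&
  [forall q : 'I_n * 'I_n,
     [&& unary B q, q.1 <= p.1 & p.2 <= q.2] ==> (q == p)].

Definition nruns B : nat := #|[set p | is_run B p]|.

Definition access (i : 'I_n) B : 'I_sigma := tnth B i.

(* Occurrences in B[0..i], position i included. *)
Definition rank c (i : 'I_n) B : nat := count_mem c (take i.+1 B).

(* Positions are 0-based while occurrences are counted from 1; the default
   value of [nth] covers the case of fewer than [i] occurrences. *)
Definition select c (i : int) B : int :=
  if i is Posz k.+1 then
    nth (- 1)%R [seq Posz (val j) | j <- enum 'I_n & tnth B j == c] k
  else (- 1)%R.

End Strings.

Definition run_string (n sigma r : nat) : Type :=
  {B : n.-tuple 'I_sigma | nruns B == r}.

(* Deterministic adaptive cell-probe algorithms over a memory of [S] cells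
   of [w] bits: decision trees branching on the content of the probed cell.
   Computation between probes is free. *)
Inductive probe_tree (w S : nat) (A : Type) : Type :=
| Answer of A
| Probe of 'I_S & (w.-tuple bool -> probe_tree w S A).

Section CellProbe.
Variables (w S : nat).
Local Notation memory := {ffun 'I_S -> w.-tuple bool}.

Fixpoint run (A : Type) (t : probe_tree w S A) (m : memory) : A :=
  match t with
  | Answer a => a
  | Probe j next => run (next (m j)) m
  end.

Fixpoint nprobes (A : Type) (t : probe_tree w S A) (m : memory) : nat :=
  match t with
  | Answer _ => 0
  | Probe j next => (nprobes (next (m j)) m).+1
  end.

(* A structure occupies [S * w] bits.  The preprocessing [encode] is
   arbitrary, and the algorithm of a query depends on the query only. *)
Record data_structure (X Q A : Type) (f : Q -> X -> A) := DataStructure {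
  encode : X -> memory;
  algorithm : Q -> probe_tree w S A;
  _ : forall (x : X) (q : Q), run (algorithm q) (encode x) = f q x }.

Definition query_time (X Q A : Type) (f : Q -> X -> A)
    (D : data_structure f) (x : X) (q : Q) : nat :=
  nprobes (algorithm D q) (encode D x).

End CellProbe.

Section Queries.
Variables n sigma r : nat.

Definition rank_problem (q : 'I_sigma * 'I_n) (B : run_string n sigma r) : nat :=
  rank q.1 q.2 (val B).

Definition select_problem (q : 'I_sigma * int) (B : run_string n sigma r) : int :=
  select q.1 q.2 (val B).

Definition access_problem (i : 'I_n) (B : run_string n sigma r) : 'I_sigma :=
  access i (val B).

End Queries.

(* Main.v *)
(** The access, rank and select problems encode a family of colored predecessor
problems, for which the following round elimination in the cell-probe model
gives the lower bound.  A database consists of many independent blocks; one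
keeps a family of databases of density [2 ^- P], with [P] much smaller than the
number of blocks, and for every block a set of positive density of queries.
One step halves the length of a query, replaces every block by many smaller
ones and publishes the contents of few cells, so that one probe becomes
superfluous; since the published bits remain few compared to the number of new
blocks, after [T] steps some block still has two possible answers although no
probe is left.  Runs of a binary string encode the blocks for access and select,
and for rank when [n / r] is large.  When the alphabet is large, letters play
the role of blocks, and one extra probe into a table of positions compensates
for the fact that the position of a block boundary depends on the data. *)

Require Import Defs.
From mathcomp Require Import all_boot all_order all_algebra.
From mathcomp Require Import reals exp.
From mathcomp Require Import boolp zify ring lra.

Set Implicit Arguments.
Unset Strict Implicit.
Unset Printing Implicit Defensive.

(** * Counting *)

(** The obstacle is space. Suppose there are [N] cells per block. Hitting the fat first halves takes
    about [N / tau] cells per block and a thin one takes [tau], so [tau] is of the order of the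
    square root of [N]. With [h = tau * b ^ 3] the new blocks outnumber the published bits by a
    factor [b], and the space per new block is again about the square root of [N]. Hence the arities
    [b ^ (G * 2 ^ s)], whose exponent doubles with the level: the number of steps is logarithmic in
    the logarithm to base [b] of the size of a block. The base [b] is a power of [log n] that
    absorbs word size, the logarithmic factor of hitting sets, losses of density and redundancy; it
    is the source of the denominator [log log n]. The lower bound on [r] provides the runs for at
    least [b] blocks of the chosen depth, and [delta] affects constants only. *)

Lemma exists_ge_average (T : finType) (F : T -> nat) (s : nat) :
  0 < #|T| -> s <= \sum_(a : T) F a -> exists a, s <= F a * #|T|.
Proof.
move=> T0 hs; have [a0 _] : exists a0 : T, true by case/card_gt0P: T0 => a; exists a.
pose a := [arg max_(a > a0) F a]; exists a; apply: leq_trans hs _.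
rewrite mulnC -sum_nat_const; apply: leq_sum => i _.
by rewrite /a; case: arg_maxnP => // j _; apply.
Qed.

Lemma pigeonhole_set (A B : finType) (g : A -> B) (E : {set A}) :
  0 < #|E| -> exists b, #|E| <= #|[set a in E | g a == b]| * #|B|.
Proof.
move=> E0; apply: exists_ge_average.
  by case/card_gt0P: E0 => a _; apply/card_gt0P; exists (g a).
rewrite -sum1_card (partition_big g predT) //=; apply: leq_sum => b _.
by rewrite -sum1_card; apply/eq_leq/eq_bigl => a; rewrite inE.
Qed.

(** Sections of density below [1 / (2 * M)] account for at most half of the density [1 / M]; the
    other half needs many sections, as each has density at most 1. *)
Lemma card_dense_sections (A B : finType) (U : {set A * B}) (M : nat) :
  0 < #|B| -> #|A| * #|B| <= #|U| * M ->
  #|A| <= #|[set a | #|B| <= #|[set b | (a, b) \in U]| * M.*2]| * M.*2.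
Proof.
move=> B0 hU; set L := [set a | _].
have cU : #|U| = \sum_a #|[set b | (a, b) \in U]|.
  rewrite -sum1_card (partition_big fst predT) //=; apply: eq_bigr => a _.
  rewrite -sum1_card (reindex_onto (pair a) snd) /=; last first.
    by case=> a' b /= /andP[_ /eqP ->].
  by apply: eq_bigl => b; rewrite inE !eqxx !andbT.
have : \sum_a #|[set b | (a, b) \in U]| * M.*2 <= \sum_a ((a \in L) * #|B| * M.*2 + #|B|).
  apply: leq_sum => a _; case: (boolP (a \in L)) => [_|].
    by rewrite mul1n; apply: leq_trans (leq_addr _ _); rewrite leq_mul2r max_card orbT.
  by rewrite inE -ltnNge => /ltnW; rewrite mul0n.
rewrite -big_distrl -cU big_split /= sum_nat_const -!big_distrl /= -big_mkcond /=.
rewrite sum1_card => h1.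
have h2 : #|A| * #|B| <= #|L| * M.*2 * #|B|.
  have eA : #|(fun=> true) : pred A| = #|A| by apply: eq_card.
  rewrite eA in h1; move: h1; rewrite -!muln2; move: hU.
  move: #|A| #|B| #|U| #|L| => *; lia.
by rewrite leq_pmul2r in h2.
Qed.

(** Greedy choice: while more than half of [Q] is missed, double counting gives a point in a
    fraction [tau / #|Z|] of the missed sets, so each round hits at least [#|Q| / (2 * q)] new
    ones. *)
Lemma exists_hitting_half (K Z : finType) (Fam : K -> {set Z}) (Q : {set K}) (tau q : nat) :
  0 < tau -> #|Z| <= q * tau -> (forall x, x \in Q -> tau <= #|Fam x|) ->
  exists2 R : {set Z}, #|R| <= q.*2 &
    #|[set x in Q | [disjoint R & Fam x]]|.*2 <= #|Q|.
Proof.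
move=> tau0 hZ hF.
pose un (R : {set Z}) := [set x in Q | [disjoint R & Fam x]].
have unQ R : #|un R| <= #|Q|.
  by apply/subset_leq_card/subsetP => x; rewrite inE => /andP[].
have Zpos x : x \in Q -> 0 < #|Z|.
  by move=> /hF hx; apply: leq_trans tau0 (leq_trans hx (max_card _)).
suff H j : exists2 R : {set Z}, #|R| <= j &
    (#|un R|.*2 <= #|Q|) \/ (#|Q| * tau * j <= (#|Z| * (#|Q| - #|un R|)).*2).
  have [R hR [?|h]] := H q.*2; exists R => //; rewrite -/(un R).
  have [Q0|/card_gt0P[x /Zpos Z0]] := posnP #|Q|; first by have := unQ R; lia.
  have h1 : #|Z| * #|Q| <= q * tau * #|Q| by rewrite leq_mul2r hZ orbT.
  have h2 : #|Z| * #|Q| <= #|Z| * (#|Q| - #|un R|) by lia.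
  by rewrite leq_pmul2l // in h2; have := unQ R; lia.
elim: j => [|j [R hR IH]]; first by exists set0; rewrite ?cards0 //; right; rewrite muln0.
have [small|large] := leqP #|un R|.*2 #|Q|.
  by exists R; [apply: leq_trans hR _|left].
have {}IH : #|Q| * tau * j <= (#|Z| * (#|Q| - #|un R|)).*2 by case: IH => //; lia.
have [x /setIdP[/Zpos Z0 _]] : exists x, x \in un R by apply/card_gt0P; lia.
have : #|un R| * tau <= \sum_z #|[set x in un R | z \in Fam x]|.
  under eq_bigr => z _ do rewrite -sum1_card.
  rewrite -sum_nat_const (exchange_big_dep (mem (un R))) /=; last by move=> z y _ /setIdP[].
  apply: leq_sum => y yu; rewrite sum1_card (_ : #|_| = #|Fam y|).
    by move: yu => /setIdP[/hF].
  by apply: eq_card => z; transitivity (y \in [set x0 in un R | z \in Fam x0]); [|rewrite in_set yu].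
case/(exists_ge_average Z0) => z hz.
have hu : #|un (z |: R)| + #|[set x in un R | z \in Fam x]| <= #|un R|.
  rewrite -[leqRHS](cardsID [set y | z \in Fam y]) addnC; apply: leq_add; apply/subset_leq_card/subsetP => y.
    by rewrite !inE.
  rewrite !inE => /andP[-> d]; rewrite (disjointWl _ d) ?subsetUr //=.
  by rewrite (disjointFr d) // setU11.
exists (z |: R); first by rewrite cardsU1; case: (z \notin R) => /=; lia.
right; have := unQ R; move: hu hz IH large; set u := #|un R|; set u' := #|un _|.
set t := #|[set _ in _ | _]| => hu hz IH large uQ.
have e1 : #|Z| * (#|Q| - u) + #|Z| * t <= #|Z| * (#|Q| - u').
  by rewrite -mulnDr leq_mul2l; apply/orP; right; lia.
have e2 : #|Q| * tau <= u.*2 * tau by rewrite leq_mul2r (ltnW large) orbT.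
by rewrite mulnS; lia.
Qed.

Lemma exists_hitting_set (K Z : finType) (Fam : K -> {set Z}) (Q : {set K}) (tau q l : nat) :
  0 < tau -> #|Z| <= q * tau -> (forall x, x \in Q -> tau <= #|Fam x|) ->
  #|Q| < 2 ^ l ->
  exists2 R : {set Z}, #|R| <= q.*2 * l &
    forall x, x \in Q -> exists2 z, z \in R & z \in Fam x.
Proof.
move=> tau0 hZ; elim: l Q => [|l IH] Q hF hQ.
  exists set0; rewrite ?cards0 // => x xQ.
  by have : 0 < #|Q| by [apply/card_gt0P; exists x]; lia.
have [R1 hR1 h1] := exists_hitting_half tau0 hZ hF.
have [||R2 hR2 h2] := IH [set x in Q | [disjoint R1 & Fam x]].
- by move=> x /setIdP[/hF].
- by move: hQ; rewrite expnS; lia.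
exists (R1 :|: R2); first by apply: leq_trans (leq_card_setU _ _) _; rewrite mulnS leq_add.
move=> x xQ; case: (boolP [disjoint R1 & Fam x]) => [d|].
  by have [|z zR zF] := h2 x; [rewrite inE xQ|exists z => //; rewrite inE zR orbT].
by case/pred0Pn => z /andP[/= zR zF]; exists z => //; rewrite inE zR.
Qed.

(** The first two binomial terms of [(K.-1 + 1) ^ K] are each at least [K.-1 ^ K]. This is
    [(1 - 1 / K) ^ K <= 1 / 2] in integers. *)
Lemma pow_pred_double (K : nat) : 0 < K -> 2 * K.-1 ^ K <= K ^ K.
Proof.
case: K => // K _ /=; case: K => // K.
rewrite -[in leqRHS]addn1 expnDn big_ord_recl /= big_ord_recl /= subn0 bin0 bin1 !mul1n.
rewrite !exp1n !muln1 addnA mul2n -addnn; apply: leq_trans (leq_addr _ _).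
by rewrite addn1 leq_add2l /bump subSS subn0 expnS leq_mul.
Qed.

(* Exponential moments: weigh a pattern by [2] to the number of its bad coordinates. *)
Lemma card_few_good (I A : finType) (good : I -> {set A}) (K j : nat) :
  0 < K -> (forall i, #|A|.*2 <= #|good i| * K) -> j <= #|I| ->
  #|[set s : {ffun I -> A} | #|[set i | s i \in good i]| <= j]| * 2 ^ (#|I| %/ K)
    <= 2 ^ j * #|A| ^ #|I|.
Proof.
move=> K0 hg hj; set B := [set _ | _]; set k := #|I|.
pose wt (i : I) (a : A) := 2 ^ (a \notin good i).
have e1 : #|B| * 2 ^ (k - j) <= \prod_(i : I) \sum_a wt i a.
  rewrite bigA_distr_bigA /= -sum_nat_const [leqRHS](bigID (mem B)) /=.
  apply: leq_trans (leq_addr _ _); apply: leq_sum => s; rewrite inE => hs.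
  rewrite /wt -expn_sum leq_exp2l // -big_mkcond sum1_card /k.
  rewrite -(cardC [set i | s i \in good i]) leq_subLR.
  apply: leq_add => //; apply/subset_leq_card/subsetP => i.
  by rewrite !inE.
(* Good letters have density at least [2 / K], so the mean weight of a coordinate is at most
   [2 * (1 - 1 / K)]. *)
have e2 i : (\sum_a wt i a) * K <= #|A|.*2 * K.-1.
  rewrite (_ : \sum_a wt i a = #|A| + #|~: good i|).
    by have := hg i; have := cardsC (good i); nia.
  rewrite -[#|A|]sum1_card -[#|~: _|]sum1_card [X in _ + X]big_mkcond /= -big_split /=.
  by apply: eq_bigr => a _; rewrite /wt inE; case: (a \in good i).
have e3 : (\prod_(i : I) \sum_a wt i a) * K ^ k <= #|A|.*2 ^ k * K.-1 ^ k.
  rewrite -expnMn /k -!prod_nat_const -big_split /=; apply: leq_prod => i _; exact: e2.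
have e4 : 2 ^ (k %/ K) * K.-1 ^ k <= K ^ k.
  rewrite {2 3}(divn_eq k K) !expnD mulnA leq_mul //; last by case: (k %% K) => // e; rewrite leq_exp2r ?leq_pred.
  rewrite ![_ * K]mulnC !expnM -expnMn; case: (k %/ K) => // e.
  by rewrite leq_exp2r ?pow_pred_double.
have c0 : 0 < 2 ^ (k - j) * K ^ k by rewrite muln_gt0 !expn_gt0 K0.
rewrite -(leq_pmul2r c0).
have -> : 2 ^ j * #|A| ^ k * (2 ^ (k - j) * K ^ k) = #|A|.*2 ^ k * K ^ k.
  by rewrite -mul2n expnMn (_ : 2 ^ k = 2 ^ j * 2 ^ (k - j)); [lia|rewrite -expnD subnKC].
apply: leq_trans (_ : #|A|.*2 ^ k * K.-1 ^ k * 2 ^ (k %/ K) <= _); last first.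
  by rewrite -mulnA [K.-1 ^ k * _]mulnC leq_mul2l e4 orbT.
have : #|B| * 2 ^ (k - j) * K ^ k <= #|A|.*2 ^ k * K.-1 ^ k.
  by apply: leq_trans e3; rewrite leq_mul2r e1 orbT.
move=> /(leq_mul (leqnn (2 ^ (k %/ K)))).
move: (2 ^ (k %/ K)) (2 ^ (k - j)) (K ^ k) (K.-1 ^ k) (#|A|.*2 ^ k) => a b c d e.
by rewrite [a * (e * d)]mulnC; apply: leq_trans; lia.
Qed.

(** Fixing the first components of all coordinates costs a single bit of density. Of the density
    [2 ^- P], slices sparser than [2 ^- P.+1] carry at most a half, and patterns with few good
    coordinates at most a quarter, by [card_few_good]. *)
Lemma exists_good_pattern (I A E : finType) (good : I -> {set A})
    (Fam : {set {ffun I -> A * E}}) (K P j : nat) :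
  0 < K -> (forall i, #|A|.*2 <= #|good i| * K) -> P + j + 2 <= #|I| %/ K ->
  0 < #|A| -> 0 < #|E| -> (#|A| * #|E|) ^ #|I| <= #|Fam| * 2 ^ P ->
  exists2 s : {ffun I -> A}, j < #|[set i | s i \in good i]| &
    #|E| ^ #|I| <= #|[set e : {ffun I -> E} | [ffun i => (s i, e i)] \in Fam]| * 2 ^ P.+1.
Proof.
move=> K0 hg hP A0 E0 hFam.
pose slice (s : {ffun I -> A}) := [set e : {ffun I -> E} | [ffun i => (s i, e i)] \in Fam].
have [/existsP[s /andP[]]|] := boolP [exists s : {ffun I -> A}, (j < #|[set i | s i \in good i]|) &&
    (#|E| ^ #|I| <= #|slice s| * 2 ^ P.+1)]; first by exists s.
rewrite negb_exists => /forallP hs; exfalso.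
have jI : j <= #|I| by have := leq_div #|I| K; lia.
have := card_few_good K0 hg jI; set bad := [set s | _] => hbad.
have cF : #|Fam| <= \sum_s #|slice s|.
  rewrite -sum1_card (partition_big (fun d : {ffun I -> A * E} => [ffun i => (d i).1]) predT) //=.
  apply: leq_sum => s _; rewrite sum1_card.
  apply: leq_trans (_ : #|[set [ffun i => (s i, e i)] | e : {ffun I -> E} in slice s]| <= _).
    apply/subset_leq_card/subsetP => d; rewrite unfold_in /= => /andP[dF /eqP ds].
    have ed : d = [ffun i => (s i, [ffun i => (d i).2] i)].
      by apply/ffunP => i; rewrite -ds !ffunE; case: (d i).
    by rewrite ed; apply: imset_f; rewrite inE -ed.
  exact: leq_imset_card.
have cS s : #|slice s| * 2 ^ P.+1 <= #|E| ^ #|I| + (s \in bad) * (#|E| ^ #|I| * 2 ^ P.+1).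
  have := hs s; rewrite negb_and -leqNgt inE; case: leqP => _ /=.
    move=> _; rewrite mul1n; apply: leq_trans (leq_addl _ _).
    by rewrite leq_mul2r -card_ffun max_card orbT.
  by rewrite -ltnNge => /ltnW h; rewrite mul0n addn0.
have : \sum_s #|slice s| * 2 ^ P.+1 <= #|A| ^ #|I| * #|E| ^ #|I| + #|bad| * (#|E| ^ #|I| * 2 ^ P.+1).
  apply: (@leq_trans (\sum_s (#|E| ^ #|I| + (s \in bad) * (#|E| ^ #|I| * 2 ^ P.+1)))).
    by apply: leq_sum => s _; apply: cS.
  rewrite big_split /= sum_nat_const card_ffun leq_add2l -big_distrl leq_mul2r /= -big_mkcond /=.
  by rewrite sum1_card leqnn orbT.
rewrite -big_distrl /= => hsum.
have h1 : 2 * (#|A| * #|E|) ^ #|I| <= (#|A| ^ #|I| + #|bad| * 2 ^ P.+1) * #|E| ^ #|I|.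
  have h1 := leq_mul hFam (leqnn 2).
  have h2 := leq_mul cF (leqnn (2 ^ P.+1)).
  have {h2} := leq_trans h2 hsum; move: h1; rewrite expnMn expnS; move: (#|A| ^ #|I|) (#|E| ^ #|I|) (2 ^ P) #|Fam| #|bad| => *.
  by nia.
move: h1; rewrite expnMn mulnA leq_pmul2r ?expn_gt0 ?E0 // => h1.
have h2 : #|bad| * 2 ^ (P + j + 2) <= 2 ^ j * #|A| ^ #|I|.
  by apply: leq_trans hbad; rewrite leq_mul2l leq_exp2l // hP orbT.
have h3 : #|bad| * 2 ^ (P + 2) <= #|A| ^ #|I|.
  have j0 : 0 < 2 ^ j by rewrite expn_gt0.
  rewrite -(leq_pmul2l j0); apply: leq_trans h2.
  by rewrite addnAC [2 ^ (P + 2 + j)]expnD mulnCA [2 ^ j * _]mulnC.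
have a0 : 0 < #|A| ^ #|I| by rewrite expn_gt0 A0.
by move: h1 h3 a0; rewrite addn2 !expnS; move: (#|A| ^ #|I|) (2 ^ P) #|bad|; nia.
Qed.

Definition glue (I D : finType) (J : {set I}) (e : {ffun I -> D}) (d : {ffun {i | i \in J} -> D}) :
    {ffun I -> D} :=
  [ffun i => if insub i is Some p then d p else e i].

(** Averaging over the coordinates outside [J]. As [e] is a full function, its part on [J] is
    redundant; the involution [swap] exchanges it with [d] and so turns pairs with [e] in [Fam] into
    pairs with [glue e d] in [Fam]. *)
Lemma exists_dense_restriction (I D : finType) (J : {set I}) (Fam : {set {ffun I -> D}}) (P : nat) :
  0 < #|D| -> #|D| ^ #|I| <= #|Fam| * 2 ^ P ->
  exists e, #|D| ^ #|J| <= #|[set d : {ffun {i | i \in J} -> D} | glue e d \in Fam]| * 2 ^ P.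
Proof.
move=> D0 hF; pose G e := [set d : {ffun {i | i \in J} -> D} | glue e d \in Fam].
have cJ : #|{: {i | i \in J}}| = #|J| by rewrite card_sig; apply: eq_card => i; rewrite !inE.
have hs : #|Fam| * #|D| ^ #|J| <= \sum_e #|G e|.
  have -> : #|Fam| * #|D| ^ #|J| = #|setX Fam [set: {ffun {i | i \in J} -> D}]|.
    by rewrite cardsX cardsT card_ffun cJ.
  pose res (e : {ffun I -> D}) : {ffun {i | i \in J} -> D} := [ffun p => e (val p)].
  have glueK (e : {ffun I -> D}) (d : {ffun {i | i \in J} -> D}) : glue (glue e d) (res e) = e.
    by apply/ffunP => i; rewrite !ffunE; case: insubP => [p _ <-|//]; rewrite ffunE.
  have resK e (d : {ffun {i | i \in J} -> D}) : res (glue e d) = d.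
    by apply/ffunP => p; rewrite !ffunE valK.
  pose swap (x : {ffun I -> D} * {ffun {i | i \in J} -> D}) := (glue x.1 x.2, res x.1).
  have swapI : injective swap.
    by apply: (can_inj (g := swap)) => -[e d]; rewrite /swap /= glueK resK.
  rewrite -(card_imset _ swapI).
  have -> : \sum_e #|G e| = #|[set x : {ffun I -> D} * {ffun {i | i \in J} -> D} | glue x.1 x.2 \in Fam]|.
    rewrite -[RHS]sum1_card (partition_big fst predT) //=; apply: eq_bigr => e _.
    rewrite -sum1_card (reindex_onto (pair e) snd) /=; last by case=> e' d /= /andP[_ /eqP ->].
    by apply: eq_bigl => d; rewrite !inE !eqxx !andbT.
  apply/subset_leq_card/subsetP => _ /imsetP[[e d]] /[!inE]/= /andP[eF _] ->.
  by rewrite /swap /= glueK.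
have [|e he] := exists_ge_average _ hs; first by rewrite card_ffun expn_gt0 D0.
exists e; rewrite card_ffun in he.
have c0 : 0 < #|D| ^ #|I| by rewrite expn_gt0 D0.
rewrite -(leq_pmul2l c0); apply: leq_trans (leq_mul hF (leqnn _)) _.
by have := leq_mul he (leqnn (2 ^ P)); rewrite -/(G e); lia.
Qed.

(** * Cell-probe elimination *)

(** Cells and words have arbitrary types, unlike in [probe_tree], so that a memory can be extended
    by a table with entries of another kind. *)
Inductive ptree (Cell W A : Type) : Type :=
| PAnswer of A
| PProbe of Cell & (W -> ptree Cell W A).

Section Trees.
Variables (Cell W A : Type).
Implicit Types (t : ptree Cell W A) (m : Cell -> W).

Fixpoint prun t m : A :=
  match t with PAnswer a => a | PProbe c next => prun (next (m c)) m end.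

Fixpoint pdepth t m : nat :=
  match t with PAnswer _ => 0 | PProbe c next => (pdepth (next (m c)) m).+1 end.

Definition paddr t : option Cell := if t is PProbe c _ then Some c else None.

Definition peel (rho : Cell -> option W) t : ptree Cell W A :=
  if t is PProbe c next then
    if rho c is Some x then next x else t
  else t.

Lemma peel_correct rho t m k :
  (forall c, paddr t = Some c -> rho c = Some (m c)) -> pdepth t m <= k.+1 ->
  pdepth (peel rho t) m <= k /\ prun (peel rho t) m = prun t m.
Proof. by case: t => [a|c next] //= hrho; rewrite (hrho c erefl). Qed.

End Trees.

(** Correctness is required only on [Fam] and on the sets [U i], because each elimination step keeps
    only a part of both. *)
Definition solvable (Cell W : Type) (I V D : finType) (f : D -> V -> bool)
    (Fam : {set {ffun I -> D}}) (U : I -> {set V}) (k : nat) : Prop :=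
  exists (mem : {ffun I -> D} -> Cell -> W) (tr : I -> V -> ptree Cell W bool),
    forall d, d \in Fam -> forall i u, u \in U i ->
      pdepth (tr i u) (mem d) <= k /\ prun (tr i u) (mem d) = f (d i) u.

Section Step.
Variables (V D : finType) (f : D -> V -> bool) (h : nat).

Definition halfV : finType := ('I_h * V)%type.
Definition stepV : finType := (halfV * halfV)%type.
Definition stepD : finType := ((bool * halfV) * {ffun 'I_h -> D})%type.

(* A block is either a "top" instance, whose answers depend only on the first
   half of the query, or a "bottom" one, concentrated on the single value [x0]
   of the first half; in both cases it carries [h] independent subinstances. *)
Definition stepf (d : stepD) (u : stepV) : bool :=
  let: (top, x0, e) := d in
  let: (x, y) := u in
  if top then f (e x.1) x.2 else if x == x0 then f (e y.1) y.2 else false.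

End Step.

(* For a first half [x] of the query, consider the cells that the first probe
   may reach as the second half varies.  If most [x] are "fat" (at least [tau]
   cells), make the block a top instance: a small hitting set of cells meets
   all of them.  Otherwise make it a bottom instance at a "thin" [x], which has
   fewer than [tau] cells.  Once the contents of the selected cells are fixed,
   which costs density [2 ^ w] per cell, the first probe is redundant. *)
Lemma elimination (Cell W I V D : finType) (f : D -> V -> bool) (h w l tau q M P j k : nat)
    (Fam : {set {ffun I -> stepD V D h}}) (U : I -> {set stepV V h}) :
  #|W| <= 2 ^ w -> 0 < #|V| -> 0 < #|D| -> 0 < h -> 0 < tau -> 0 < M ->
  #|Cell|.+1 <= q * tau -> #|I| * (h * #|V|) < 2 ^ l ->
  P + j + 2 <= #|I| %/ (16 * M) ->
  #|stepD V D h| ^ #|I| <= #|Fam| * 2 ^ P ->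
  (forall i, #|stepV V h| <= #|U i| * M) ->
  @solvable Cell W _ _ _ (stepf f (h := h)) Fam U k.+1 ->
  exists (I' : finType) (Fam' : {set {ffun I' -> D}}) (U' : I' -> {set V}),
  [/\ j.+1 * h <= #|I'| * (8 * M), #|I'| <= #|I| * h,
      #|D| ^ #|I'| <= #|Fam'| * 2 ^ (P.+1 + w * (q.*2 * l + #|I| * tau)),
      forall i, #|V| <= #|U' i| * (8 * M)
    & @solvable Cell W _ _ _ f Fam' U' k].
Proof.
move=> hW V0 D0 h0 tau0 M0 hq hl hP hFam hU [cells [tr htr]].
pose X := halfV V h.
have cX : #|X| = h * #|V| by rewrite card_prod card_ord.
have X0 : 0 < #|X| by rewrite cX muln_gt0 h0.
pose sec i (x : X) : {set X} := [set y | (x, y) \in U i].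
pose live i := [set x | #|X| <= #|sec i x| * M.*2].
have hlive i : #|X| <= #|live i| * M.*2.
  by apply: card_dense_sections => //; rewrite -card_prod; apply: hU.
(* [None], the address of a tree that answers at once, counts as one more cell; this is the [.+1] in
   the bound on [#|Cell|]. *)
pose C i x : {set option Cell} := [set paddr (tr i (x, y)) | y in sec i x].
pose fat i := [set x in live i | tau <= #|C i x|].
pose top i := #|X| <= #|fat i| * (4 * M).
pose good i : {set (bool * X)%type} :=
  [set p | if top i then p.1 else ~~ p.1 && (p.2 \in live i :\: fat i)].
(* If fat values have density below [1 / (4 * M)], thin ones have at least that, since live ones
   have [1 / (2 * M)]. Fixing the bit halves it, and [exists_good_pattern] demands another factor
   2. *)
have hgood i : #|{: bool * X}|.*2 <= #|good i| * (16 * M).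
  rewrite card_prod card_bool /good; case: (boolP (top i)) => /= hfat.
    have : #|setX [set true] [set: X]| <= #|[set p : bool * X | p.1]|.
      by apply/subset_leq_card/subsetP => -[b x]; rewrite !inE /= => /andP[/eqP ->].
    rewrite cardsX cards1 cardsT; set a := #|_|; set b := #|_| => hb.
    by have : a * (16 * 1) <= a * (16 * M) by [rewrite !leq_mul]; lia.
  rewrite /top -ltnNge in hfat.
  have : #|setX [set false] (live i :\: fat i)| <= #|[set p : bool * X | ~~ p.1 && (p.2 \in live i :\: fat i)]|.
    by apply/subset_leq_card/subsetP => -[b x]; rewrite !inE /= => /andP[/eqP ->].
  have : #|live i| <= #|fat i| + #|live i :\: fat i|.
    rewrite -(cardsID (fat i) (live i)) leq_add2r.
    by apply/subset_leq_card/subsetP => x; rewrite inE => /andP[].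
  rewrite cardsX cards1 mul1n; move: (hlive i) hfat; rewrite /X /=.
  move: #|live i| #|fat i| #|_ :\: _| #|_| => a b c x h1 h2 /(leq_mul (leqnn M)) h3.
  by move: #|_| => e /(leq_mul (leqnn M)) h4; lia.
have [R0 hR0 R0P] : exists2 R : {set option Cell}, #|R| <= q.*2 * l &
    forall p : I * X, p \in [set p | p.2 \in fat p.1] -> exists2 z, z \in R & z \in C p.1 p.2.
  apply: (exists_hitting_set tau0); first by rewrite card_option.
    by move=> p; rewrite !inE => /andP[].
  by apply: leq_ltn_trans (max_card _) _; rewrite card_prod cX.
have [] := exists_good_pattern _ hgood hP _ _ _ (Fam := Fam) => //.
- by rewrite muln_gt0 M0.
- by rewrite card_prod card_bool muln_gt0 X0.
- by rewrite card_ffun expn_gt0 D0.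
- by rewrite -card_prod.
move=> s; set J := [set i | _] => hJ; set Fs := [set e | _] => hFs.
pose U2 i z : {set V} :=
  if (s i).1 then [set v | (z, v) \in fat i] else [set v | (z, v) \in sec i (s i).2].
pose gz i := [set z | #|V| <= #|U2 i z| * (8 * M)].
have hgz i : i \in J -> h <= #|gz i| * (8 * M).
  rewrite inE /good inE => hi.
  (* In both cases the usable queries have density [1 / (4 * M)] in [X]; cutting them by subinstance
     doubles the loss, hence [8 * M]. *)
  have [S hS cS] : exists2 S : {set X}, forall z, U2 i z = [set v | (z, v) \in S]
      & #|X| <= #|S| * (4 * M).
    move: hi; have [htop hi|htop /andP[hi]] := boolP (top i).
      by exists (fat i) => // z; rewrite /U2 hi.
    rewrite inE [_ \in live i]inE => /andP[_ hx]; exists (sec i (s i).2); first by move=> z; rewrite /U2 (negbTE hi).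
    by apply: leq_trans hx _; rewrite leq_mul2l; apply/orP; right; lia.
  have := @card_dense_sections _ _ S (4 * M) V0; rewrite -card_prod => /(_ cS).
  rewrite card_ord (_ : (4 * M).*2 = 8 * M); last by lia.
  by under eq_finset => z do rewrite -hS.
pose J' := [set p : I * 'I_h | (p.1 \in J) && (p.2 \in gz p.1)].
have cJ' : j.+1 * h <= #|J'| * (8 * M).
  have -> : #|J'| = \sum_(i in J) #|gz i|.
    under eq_bigr => i _ do rewrite -sum1_card.
    by rewrite pair_big_dep -sum1_card; apply: eq_bigl => p; rewrite inE.
  rewrite big_distrl /=; apply: (@leq_trans (\sum_(i in J) h)).
    by rewrite sum_nat_const leq_mul2r hJ orbT.
  exact: leq_sum.
pose Fam1 := [set d : {ffun I * 'I_h -> D} |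
  [ffun i => (s i, [ffun z => d (i, z)])] \in Fam].
have hFam1 : #|D| ^ #|{: I * 'I_h}| <= #|Fam1| * 2 ^ P.+1.
  rewrite card_prod card_ord mulnC expnM; move: hFs; rewrite card_ffun card_ord => hFs.
  apply: leq_trans hFs _; rewrite leq_mul2r; apply/orP; right.
  pose unc (e : {ffun I -> {ffun 'I_h -> D}}) := [ffun p : I * 'I_h => e p.1 p.2].
  have uncI : injective unc.
    move=> e e' /ffunP he; apply/ffunP => i; apply/ffunP => z.
    by have := he (i, z); rewrite !ffunE.
  rewrite -(card_imset _ uncI); apply/subset_leq_card/subsetP => _ /imsetP[e eF ->].
  move: eF; rewrite !inE; congr (_ \in Fam); apply/ffunP => i; rewrite !ffunE.
  by congr (_, _); apply/ffunP => z; rewrite !ffunE.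
have [e0 he0] := exists_dense_restriction J' D0 hFam1.
set Fam2 := [set d | _] in he0.
pose I' := {p | p \in J'} : finType.
have cI' : #|I'| = #|J'| by rewrite card_sig; apply: eq_card => p; rewrite !inE.
pose full (d : {ffun I' -> D}) : {ffun I -> stepD V D h} :=
  [ffun i => (s i, [ffun z => glue e0 d (i, z)])].
have fullE d i z (p : (i, z) \in J') : (full d i).2 z = d (Sub (i, z) p).
  rewrite !ffunE; case: insubP => [p' _ hp'|]; last by rewrite p.
  by congr (d _); apply: val_inj.
(* The hitting set serves all top blocks at once; each bottom block adds the fewer than [tau] cells
   of its thin value. *)
pose R := R0 :|: \bigcup_(i | (i \in J) && ~~ (s i).1) C i (s i).2.
have cR : #|R| <= q.*2 * l + #|I| * tau.
  apply: leq_trans (leq_card_setU _ _) _; apply: leq_add => //.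
  apply: (@leq_trans (\sum_(i | (i \in J) && ~~ (s i).1) #|C i (s i).2|)).
    elim/big_rec2: _ => [|i A B _ IH]; first by rewrite cards0.
    by apply: leq_trans (leq_card_setU _ _) _; rewrite leq_add2l.
  apply: (@leq_trans (\sum_(i | (i \in J) && ~~ (s i).1) tau)).
    apply: leq_sum => i /andP[]; rewrite inE /good inE.
    case: (boolP (top i)) => _ => [-> //|/andP[-> +] _].
    by rewrite !inE => /andP[/nandP[/negP //|]]; rewrite -ltnNge => /ltnW.
  by rewrite sum_nat_const leq_mul2r max_card orbT.
pose Rc := [set c : Cell | Some c \in R].
have cRc : #|Rc| <= #|R|.
  have someI : injective (@Some Cell) by move=> a b [].
  rewrite -(card_imset (mem Rc) someI); apply/subset_leq_card/subsetP.
  by move=> _ /imsetP[c cR' ->]; have : c \in Rc := cR'; rewrite inE.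
pose pub d : {ffun {c | c \in Rc} -> W} := [ffun c => cells (full d) (val c)].
have F20 : 0 < #|Fam2|.
  by have := leq_trans (_ : 0 < #|D| ^ #|J'|) he0; rewrite expn_gt0 D0 muln_gt0 => /(_ isT)/andP[].
have [rho hrho] := pigeonhole_set pub F20.
set Fam' := [set a in Fam2 | _] in hrho.
exists I', Fam', (fun p => U2 (val p).1 (val p).2); split.
- by rewrite cI'.
- by rewrite cI' (leq_trans (max_card _)) // card_prod card_ord.
- rewrite cI'; apply: leq_trans he0 _; rewrite expnD mulnCA [leqRHS]mulnC leq_mul2r.
  apply/orP; right; apply: leq_trans hrho _; rewrite leq_mul2l; apply/orP; right.
  rewrite card_ffun card_sig expnM.
  have -> : #|[pred c | c \in Rc]| = #|Rc| by apply: eq_card => c; rewrite !inE.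
  apply: (@leq_trans ((2 ^ w) ^ #|Rc|)); first by case: #|Rc| => // e; rewrite leq_exp2r.
  by rewrite leq_pexp2l ?expn_gt0 // (leq_trans cRc).
- by case=> p pJ /=; move: pJ; rewrite inE => /andP[_]; rewrite inE.
(* A top instance ignores the second half, which may therefore be chosen with its first probe in
   [R0]. The choice depends on the trees, not on the database; the default [x] is never reached for
   a query of the new sets. *)
pose ysel i (x : X) : X := odflt x [pick y in sec i x | paddr (tr i (x, y)) \in R0].
pose qry (p : I') v : stepV V h :=
  let i := (val p).1 in let x := ((val p).2, v) in
  if (s i).1 then (x, ysel i x) else ((s i).2, x).
pose rho' c : option W := omap rho (insub c).
exists (fun d => cells (full d)), (fun p v => peel rho' (tr (val p).1 (qry p v))).
move=> d /setIdP[dF /eqP drho] [[i z] pJ] v /= vU.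
have iJ : i \in J by move: pJ; rewrite inE => /andP[].
have [qU qR qf] : [/\ qry (Sub (i, z) pJ) v \in U i,
    paddr (tr i (qry (Sub (i, z) pJ) v)) \in R
  & stepf f (full d i) (qry (Sub (i, z) pJ) v) = f (d (Sub (i, z) pJ)) v].
  have fullz : (full d i).2 z = d (Sub (i, z) pJ) by rewrite fullE.
  have full1 : (full d i).1 = s i by rewrite !ffunE.
  move: fullz full1 vU; rewrite /qry /U2 /=; case: (full d i) => [[t0 x0] e] /= ez e1.
  rewrite -ez -e1 /=; case: t0 e1 => /= e1; rewrite inE => vU.
    have /R0P[c cR0] : (i, (z, v) : X) \in [set p : I * X | p.2 \in fat p.1] by rewrite inE.
    case/imsetP => y ysec yc; rewrite /ysel; case: pickP => [y' /andP[ys yR]|/(_ y)].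
      by split => //; [move: ys; rewrite inE|rewrite inE yR].
    by rewrite /= ysec -yc cR0.
  split; [by move: vU; rewrite inE| |by rewrite eqxx].
  rewrite inE; apply/orP; right; apply/bigcupP; exists i; first by rewrite iJ -e1.
  by rewrite -e1 /=; apply: imset_f.
have dFam : full d \in Fam by move: dF; rewrite !inE.
have [hdep hrun] := htr _ dFam i _ qU.
have [|hd ->] := peel_correct _ hdep (rho := rho').
  move=> c hc; have cRc' : c \in Rc by rewrite inE -hc.
  by rewrite /rho' (insubT (mem Rc) cRc') /= -drho ffunE.
by rewrite hrun qf.
Qed.

(** * The recursive hard problem and its lower bound *)

Section HardProblem.
Variable h : nat -> nat.

Fixpoint hardV t : finType := if t is t.+1 then stepV (hardV t) (h t) else unit.

Fixpoint hardD t : finType :=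
  if t is t.+1 then stepD (hardV t) (hardD t) (h t) else bool.

Fixpoint hardf t : hardD t -> hardV t -> bool :=
  match t with
  | 0 => fun d _ => d
  | t.+1 => stepf (@hardf t) (h := h t)
  end.

Lemma card_hardV_gt0 t : (forall s, 0 < h s) -> 0 < #|hardV t|.
Proof.
move=> h0; elim: t => [|t IH]; first by rewrite card_unit.
by rewrite /= !card_prod card_ord !muln_gt0 h0 IH.
Qed.

Lemma card_hardD_gt0 t : (forall s, 0 < h s) -> 0 < #|hardD t|.
Proof.
move=> h0; elim: t => [|t IH]; first by rewrite card_bool.
by rewrite /= !card_prod card_bool card_ord card_ffun card_ord !muln_gt0 h0 expn_gt0 IH card_hardV_gt0.
Qed.

End HardProblem.

(** The exponents satisfy [e (t + 1) = 2 * (e t + G * 2 ^ t)]. Up to the factor [G * t], the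
    logarithm of the universe to base [b] is [2 ^ t]. *)
Lemma card_hardV b G t :
  #|hardV (fun s => b ^ (G * 2 ^ s)) t| = b ^ (G * t * 2 ^ t).
Proof.
elim: t => [|t IH]; first by rewrite card_unit muln0 mul0n.
rewrite /= !card_prod card_ord IH -!expnD; congr (b ^ _); rewrite expnS; lia.
Qed.

(** One probe is eliminated per level. The number of blocks falls short of the ideal factor [h t] by
    less than [b], hence the [- t] in the space bound; [T + 6 <= G] keeps the truncated subtractions
    exact. *)
Lemma hard_not_solvable (Cell W I : finType) (b G w l T t P M : nat) :
  let h := fun s => b ^ (G * 2 ^ s) in
  forall (Fam : {set {ffun I -> hardD h t}}) (U : I -> {set hardV h t}),
  #|W| <= 2 ^ w -> 2 + w + 4 * w * l.+1 <= b -> 512 * 64 ^ T <= b -> T + 6 <= G -> t <= T ->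
  0 < M -> M * 8 ^ t <= 8 ^ T ->
  b <= #|I| -> #|Cell|.+1 <= #|I| * b ^ (G * 2 ^ t - 6 - t) -> P * b <= #|I| ->
  #|I| * #|hardV h t| <= 2 ^ l ->
  #|hardD h t| ^ #|I| <= #|Fam| * 2 ^ P ->
  (forall i, #|hardV h t| <= #|U i| * M) ->
  ~ @solvable Cell W _ _ _ (@hardf h t) Fam U t.
Proof.
move=> h Fam U hW hb1 hb2 hG; have b0 : 0 < b by lia.
have h0 s : 0 < h s by rewrite expn_gt0 b0.
elim: t I P M Fam U => [|t IH] I P M Fam U htT M0 hM hI hN hP hl hFam hU.
  case=> cells [tr htr].
  (* Without probes the answers do not depend on the database, so [Fam] has at most one member and
     density at most [2 ^- #|I|], against [P * b <= #|I|]. *)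
  have card1 : #|Fam| <= 1.
    apply/card_le1_eqP => d d' dF dF'; apply/ffunP => i.
    have ttU : tt \in U i.
      have : 0 < #|U i| by have := hU i; rewrite card_unit; case: #|_| => //; rewrite mul0n.
      by case/card_gt0P => -[].
    have := htr _ dF i _ ttU; have := htr _ dF' i _ ttU.
    by case: (tr i tt) => [a|c next] /= [] // _ <- [_ <-].
  have : 2 ^ #|I| <= 2 ^ P by rewrite card_bool in hFam; apply: leq_trans hFam _; nia.
  rewrite leq_exp2l // => hIP.
  have : P * 2 <= #|I| by apply: leq_trans hP; rewrite leq_mul2l; apply/orP; right; lia.
  by lia.
have hM2 : 512 * (M * M) <= b.
  apply: leq_trans hb2; rewrite leq_mul2l /= (_ : 64 = 8 * 8) // expnMn.
  have hM' : M <= 8 ^ T by apply: leq_trans hM; rewrite leq_pmulr // expn_gt0.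
  by apply: leq_mul.
(* As [h t = tau * b ^ 3], three factors [b] are spare: one for the loss [512 * (M * M)] of blocks,
   one for word size and hitting-set overhead, one to restore [P * b <= #|I|]. The choice of [j]
   leaves room for [P + 2]. *)
pose g := G * 2 ^ t; pose tau := b ^ (g - 3); pose k := #|I|; pose j := k %/ (64 * M).
have g6 : T + 6 <= g by apply: leq_trans hG _; rewrite leq_pmulr // expn_gt0.
have tau0 : 0 < tau by rewrite expn_gt0 b0.
have h3 : h t = tau * (b * b * b).
  by rewrite (_ : b * b * b = b ^ 3) ; [rewrite -expnD subnK //; lia|rewrite !expnS; lia].
have hN2 : #|Cell|.+1 <= k * tau * tau.
  apply: leq_trans hN _; rewrite -mulnA leq_mul2l -expnD leq_pexp2l ?orbT //.
  by rewrite expnS /g; lia.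
have hk j' : k * h t <= j' * (512 * (M * M)) -> forall x, x * b <= k * h t -> x <= j'.
  move=> h1 x h2; rewrite -(leq_pmul2r b0); apply: leq_trans h2 (leq_trans h1 _).
  by rewrite leq_mul2l hM2 orbT.
have hM1 : 128 * M <= b.
  by apply: leq_trans hM2; rewrite -[128 * M]muln1 mulnA leq_mul //; lia.
have hj : P + j + 2 <= k %/ (16 * M).
  have M64 : 0 < 64 * M by rewrite muln_gt0.
  have hPj : P <= j by rewrite leq_divRL //; apply: leq_trans hP; rewrite leq_mul2l; apply/orP; right; lia.
  have h2j : 2 <= j by rewrite leq_divRL //; apply: leq_trans hI; lia.
  have hjk : j * (64 * M) <= k := leq_trunc_div _ _.
  rewrite leq_divRL ?muln_gt0 //; apply: leq_trans hjk.
  by rewrite (_ : 64 * M = 4 * (16 * M)) ?mulnA ?leq_mul2r; lia.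
have hlt : k * (h t * #|hardV h t|) < 2 ^ l.+1.
  rewrite expnS; move: hl; rewrite /= !card_prod card_ord -/k.
  have : 0 < h t * #|hardV h t| by rewrite muln_gt0 h0 card_hardV_gt0.
  have : 0 < 2 ^ l by rewrite expn_gt0.
  move: (h t * _) (2 ^ l) => x y y0 x0; rewrite mulnA => hxy.
  by apply: leq_ltn_trans (leq_trans (leq_pmulr _ x0) hxy) _; lia.
move=> solv.
have [I' [Fam' [U' [c1 c2 c3 c4]]]] :=
    elimination hW (card_hardV_gt0 _ h0) (card_hardD_gt0 _ h0) (h0 t) tau0 M0 hN2 hlt hj hFam hU solv.
set P' := P.+1 + _ in c3.
have kh : k * h t <= #|I'| * (512 * (M * M)).
  have : k < j.+1 * (64 * M) by rewrite ltn_ceil // muln_gt0.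
  move=> /ltnW/(leq_mul (leqnn (h t))); move/(leq_mul (leqnn (64 * M))): c1.
  rewrite (_ : 64 * M * (#|I'| * (8 * M)) = #|I'| * (512 * (M * M))); last by lia.
  rewrite [h t * k]mulnC (_ : h t * (j.+1 * (64 * M)) = 64 * M * (j.+1 * h t)); first by move=> le1 le2; apply: leq_trans le1.
  by rewrite mulnCA [RHS]mulnCA [h t * _]mulnC.
have {}hk := hk _ kh.
have kb : b <= k * tau by apply: leq_trans hI _; rewrite leq_pmulr.
apply: IH c3 c4; first exact: ltnW.
- by rewrite muln_gt0.
- by rewrite -mulnA [M * _]mulnC mulnA -expnS mulnC.
- apply: hk; rewrite h3 mulnA; apply: leq_mul => //; last by rewrite -mulnA leq_pmulr // muln_gt0 b0.
- rewrite -(leq_pmul2r b0); apply: (@leq_trans (k * h t * b ^ (g - 6 - t))).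
    apply: leq_trans (leq_mul hN (leqnn b)) _; rewrite -!mulnA leq_mul2l; apply/orP; right.
    rewrite -expnSr /h -/g -expnD leq_pexp2l // expnS mulnCA -/g; clear -g6 htT; lia.
  rewrite [leqRHS]mulnAC leq_mul2r; apply/orP; right; apply: leq_trans kh _.
  by rewrite leq_mul2l hM2 orbT.
- have Pk : P <= k by apply: leq_trans hP; rewrite leq_pmulr.
  have kx : k <= k * tau by rewrite leq_pmulr.
  have xb : P' <= k * tau * b.
    apply: (@leq_trans (k * tau * (2 + w + 4 * w * l.+1))); last by rewrite leq_mul2l hb1 orbT.
    rewrite /P'; move: (k * tau) Pk kx kb => x Pk kx kb; rewrite -muln2.
    have Px : P.+1 <= x * 2 by clear -Pk kx kb b0; lia.
    by clear -Px; lia.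
  apply: hk; rewrite h3; move/(leq_mul (leqnn (b * b))): xb.
  rewrite [b * b * P']mulnC mulnA => /leq_trans; apply; rewrite [k * (_ * _)]mulnA mulnCA.
  by rewrite leq_mul2l [_ * _ * b]mulnC leqnn orbT.
- apply: leq_trans hl; rewrite /= !card_prod card_ord.
  have : 0 < h t * #|hardV h t| by rewrite muln_gt0 h0 card_hardV_gt0.
  move: c2 => /(leq_mul (leqnn #|hardV h t|)) c2 x0; rewrite mulnA.
  apply: leq_trans (leq_pmulr _ x0); rewrite mulnC (leq_trans c2) //.
  by rewrite mulnCA [h t * _]mulnC.
Qed.

(** * Strings and runs *)

Section RunCount.
Variable T : eqType.
Implicit Types (s : seq T) (x : T).

Fixpoint changes x s : nat := if s is y :: s then (x != y) + changes y s else 0.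

Definition runs s : nat := if s is x :: s then (changes x s).+1 else 0.

Lemma changes_cat x s1 s2 : changes x (s1 ++ s2) = changes x s1 + changes (last x s1) s2.
Proof. by elim: s1 x => //= y s1 IH x; rewrite IH addnA. Qed.

Lemma changes_le_runs x s : changes x s <= runs s.
Proof. by case: s => //= y s; case: (x != y). Qed.

Lemma runs_cat s1 s2 : runs (s1 ++ s2) <= runs s1 + runs s2.
Proof. by case: s1 => //= x s1; rewrite changes_cat addSn ltnS leq_add2l changes_le_runs. Qed.

Lemma runs_flatten (ss : seq (seq T)) : runs (flatten ss) <= sumn (map runs ss).
Proof.
elim: ss => //= s ss IH; apply: leq_trans (runs_cat _ _) _.
by rewrite leq_add2l.
Qed.

Lemma changes_nseq x n : changes x (nseq n x) = 0.
Proof. by elim: n => //= n ->; rewrite eqxx. Qed.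

Lemma last_nseq x n : last x (nseq n x) = x.
Proof. by elim: n. Qed.

Lemma runs_nseq x n : runs (nseq n x) <= 1.
Proof. by case: n => //= n; rewrite changes_nseq. Qed.

Lemma runs_stretch p s : runs (flatten [seq nseq p x | x <- s]) <= runs s.
Proof.
case: p => [|p]; first by rewrite (_ : flatten _ = [::]) //; elim: s.
case: s => //= x s; rewrite changes_cat changes_nseq last_nseq ltnS add0n.
elim: s x => //= y s IH x.
by rewrite leq_add2l changes_cat changes_nseq last_nseq add0n.
Qed.

Lemma sum_changes x0 x s :
  \sum_(i < size s) (nth x0 (x :: s) i != nth x0 (x :: s) i.+1) = changes x s.
Proof.
elim: s x => [|y s IH] x /=; first by rewrite big_ord0.
by rewrite big_ord_recl /= -IH; congr (_ + _); apply: eq_bigr => i _.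
Qed.

End RunCount.

Lemma runs_map (T T' : eqType) (g : T -> T') s : runs (map g s) <= runs s.
Proof.
case: s => //= x s; rewrite ltnS; elim: s x => //= y s IH x; apply: leq_add => //.
by case: (x =P y) => [->|_]; rewrite ?eqxx // leq_b1.
Qed.

Section Nruns.
Variables (n sigma : nat) (B : n.+1.-tuple 'I_sigma) (x0 : 'I_sigma).

Let unaryP (i j : 'I_n.+1) :
  reflect (i <= j /\ forall k : nat, i <= k <= j -> nth x0 B k = nth x0 B i) (unary B (i, j)).
Proof.
apply: (iffP andP) => /= -[ij h]; split => //.
  move=> k /andP[ik kj]; have kn : k < n.+1 by apply: leq_ltn_trans kj (ltn_ord j).
  move/forallP/(_ (Ordinal kn)): h; rewrite /= ik kj /= => /eqP.
  by rewrite !(tnth_nth x0).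
by apply/forallP => k; apply/implyP => /h e; rewrite !(tnth_nth x0) e.
Qed.

(** A run is determined by its left end, and left ends are position 0 and the positions whose letter
    differs from the preceding one. *)
Lemma nruns_runs : nruns B = runs B.
Proof.
pose start (i : 'I_n.+1) := (i == 0 :> nat) || (nth x0 B i.-1 != nth x0 B i).
have startS (i j i' : 'I_n.+1) : start i -> i' <= i -> unary B (i', j) -> i <= j -> i' = i.
  move=> si le /unaryP[_ h] ij; apply: val_inj; apply/eqP; rewrite eqn_leq le leqNgt /=.
  apply/negP => lt; case/orP: si => [/eqP i0|/eqP]; first by rewrite i0 in lt.
  by apply; rewrite !h //; lia.
have -> : nruns B = #|[set i | start i]|.
  have inj : {in [set p | is_run B p] &, injective (fun p : 'I_n.+1 * 'I_n.+1 => p.1)}.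
    have key (i j j' : 'I_n.+1) : is_run B (i, j) -> unary B (i, j') -> j <= j' -> j' = j.
      by case/andP=> _ /forallP/(_ (i, j')) + u le; rewrite u /= leqnn le => /eqP[].
    move=> [i j] [i' j'] /[!inE] /= r r' e; rewrite -{i'}e in r' *.
    congr (_, _); case: (leqP j j') => [le|/ltnW le].
      by rewrite (key _ _ _ r _ le) //; case/andP: r'.
    by rewrite (key _ _ _ r' _ le) //; case/andP: r.
  rewrite /nruns -(card_in_imset inj); apply: eq_card => i; rewrite !inE.
  apply/imsetP/idP => [[[i' j] /[!inE] r /= ->]|si].
    case/andP: r => /unaryP[ij h] /forallP hmax; rewrite /start.
    case: (posnP i') => //= i0; apply/eqP => e.
    have pn : i'.-1 < n.+1 by have := ltn_ord i'; lia.
    have := hmax (Ordinal pn, j); rewrite /= leq_pred leqnn andbT.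
    case: (unaryP _ _) => [_ /= /eqP[]|]; first by move/(congr1 val) => /=; lia.
    case; split => /=; first by lia.
    move=> k /andP[k1 k2]; case: (ltngtP i'.-1 k) k1 => // [lt _|->//].
    by rewrite e h //; lia.
  pose P (j : 'I_n.+1) := unary B (i, j).
  have Pi : P i by apply/unaryP; split=> // k h; congr nth; lia.
  pose j := [arg max_(j > i | P j) (j : nat)].
  have [Pj jmax] : P j /\ forall j', P j' -> j' <= j by rewrite /j; case: arg_maxnP.
  exists (i, j) => //; rewrite inE /is_run /= -/(P j) Pj /=.
  apply/forallP => -[i' j']; apply/implyP => /= /and3P[u le1 le2].
  have ij : i <= j by case/unaryP: Pj.
  have e : i' = i by apply: startS u _ => //; lia.
  rewrite e in u *; have := jmax _ u => le3.
  by apply/eqP; congr (_, _); apply: val_inj => /=; lia.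
rewrite -sum1_card big_mkcond /=.
have : size B = n.+1 by rewrite size_tuple.
under eq_bigr => i _ do rewrite inE /start.
case: (tval B) => // x s [e]; rewrite big_ord_recl /= add1n; congr _.+1.
rewrite -(sum_changes x0) e; apply: eq_bigr => i _ /=.
by case: (_ == _).
Qed.

End Nruns.

Section Padding.
Variable sigma : nat.
Local Notation letter := 'I_sigma.+2.
Implicit Types (a : letter) (s : seq letter).

Definition other a : letter := if a == ord0 then lift ord0 ord0 else ord0.

Lemma other_neq a : a != other a.
Proof. by rewrite /other; case: (a =P ord0) => [->|/eqP]. Qed.

Fixpoint padding a m len : seq letter :=
  if len is len.+1 then
    if m is m.+1 then other a :: padding (other a) m len else a :: padding a 0 len
  else [::].

Lemma size_padding a m len : size (padding a m len) = len.
Proof. by elim: len a m => //= len IH a [|m] /=; rewrite IH. Qed.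

Lemma changes_padding a m len : m <= len -> changes a (padding a m len) = m.
Proof.
by elim: len a m => [|len IH] a [|m] //= h; rewrite ?eqxx ?(other_neq a) IH.
Qed.

(** Two alternating letters spend the missing runs and the last one is repeated up to length [n]. A
    hard prefix thus only has to satisfy inequalities. *)
Lemma exists_run_string n r s :
  0 < size s -> runs s <= r -> size s + (r - runs s) <= n ->
  exists (B : run_string n sigma.+2 r) p, tval (val B) = s ++ p.
Proof.
case: s => // x s _ hr hn.
set p := padding (last x s) (r - runs (x :: s)) (n - size (x :: s)).
have sz : size (x :: s ++ p) == n.
  by rewrite /= size_cat size_padding /=; move: hn => /=; lia.
case: n hn => [|n] hn in p sz *; first by move: hn.
have hB : nruns (Tuple sz) == r.
  rewrite (nruns_runs _ x) /= changes_cat changes_padding; first by move: hr => /=; lia.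
  by move: hn => /=; lia.
by exists (exist _ (Tuple sz) hB), p.
Qed.

End Padding.

Section QueryPrefix.
Variables (n sigma : nat) (B : n.-tuple 'I_sigma) (s p : seq 'I_sigma).
Hypothesis BE : tval B = s ++ p.

Lemma access_prefix x0 (i : 'I_n) : i < size s -> access i B = nth x0 s i.
Proof. by move=> hi; rewrite /access (tnth_nth x0) BE nth_cat hi. Qed.

Lemma rank_prefix c (i : 'I_n) : i < size s -> rank c i B = count_mem c (take i.+1 s).
Proof. by move=> hi; rewrite /rank BE takel_cat. Qed.

End QueryPrefix.

Lemma select_split n sigma (B : n.-tuple 'I_sigma) c s1 s2 :
  tval B = s1 ++ c :: s2 -> select c (Posz (count_mem c s1).+1) B = Posz (size s1).
Proof.
move=> BE; rewrite /select.
have -> : [seq Posz (val j) | j <- enum 'I_n & tnth B j == c] =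
    [seq Posz j | j <- iota 0 n & nth c B j == c].
  rewrite -val_enum_ord filter_map -map_comp.
  by congr map; apply: eq_filter => j; rewrite /= (tnth_nth c).
have -> : iota 0 n = iota 0 (size s1) ++ size s1 :: iota (size s1).+1 (size s2).
  by rewrite -(size_tuple B) BE size_cat /= iotaD.
rewrite filter_cat /= BE nth_cat ltnn subnn eqxx map_cat nth_cat size_map size_filter.
have -> : count (fun j => nth c (s1 ++ c :: s2) j == c) (iota 0 (size s1)) = count_mem c s1.
  rewrite -[in RHS](mkseq_nth c s1) count_map; apply: eq_in_count => j.
  by rewrite mem_iota /= => hj; rewrite nth_cat hj.
by rewrite ltnn subnn.
Qed.

(** Discrete derivative modulo 2, with [p] the value before the start: parities of prefix sums
    recover [s], while the ones are no more numerous than the runs of [s]. *)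
Fixpoint toggles (p : bool) (s : seq bool) : seq bool :=
  if s is a :: s then (p != a) :: toggles a s else [::].

Lemma size_toggles p s : size (toggles p s) = size s.
Proof. by elim: s p => //= a s IH p; rewrite IH. Qed.

Lemma count_toggles p s : count id (toggles p s) <= runs s.
Proof.
apply: leq_trans (changes_le_runs p s).
by elim: s p => //= a s IH p; rewrite leq_add2l.
Qed.

Lemma odd_count_toggles p s u : u < size s ->
  odd (count id (take u.+1 (toggles p s))) = p (+) nth false s u.
Proof.
elim: s p u => // a s IH p [|u] /= hu.
  by rewrite take0 /= addn0; case: p; case: a.
by rewrite oddD IH //; case: p; case: a; case: nth.
Qed.

Section BinaryStrings.
Variable sigma : nat.
Let l0 : 'I_sigma.+2 := ord0.
Let l1 : 'I_sigma.+2 := lift ord0 ord0.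

Definition bit_letter (b : bool) : 'I_sigma.+2 := if b then l1 else l0.

Definition rank_string (s : seq bool) := map bit_letter (toggles false s).

Lemma runs_bits (t : seq bool) : runs t <= (count id t).*2.+1.
Proof.
have changes_bits (b : bool) (t' : seq bool) : changes b t' <= b + (count id t').*2.
  elim: t' b => //= c t' IH b; apply: leq_trans (leq_add (leqnn _) (IH c)) _.
  by case: b; case: c => /=; lia.
by case: t => // b t /=; have := changes_bits b t; case: b => /=; lia.
Qed.

Lemma runs_rank_string s : runs (rank_string s) <= (runs s).*2.+1.
Proof.
apply: leq_trans (runs_map _ _) (leq_trans (runs_bits _) _).
by rewrite ltnS leq_double count_toggles.
Qed.

Lemma count_rank_string s u :
  count_mem l1 (take u.+1 (rank_string s)) = count id (take u.+1 (toggles false s)).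
Proof. by rewrite /rank_string -map_take count_map; apply: eq_count => -[]. Qed.

(** Each position yields exactly one [l1], preceded by [l0] where [s] changes, so the [l1] of
    position [u] stands at [u] plus the number of changes so far. *)
Definition select_block (b : bool) : seq 'I_sigma.+2 := if b then [:: l0; l1] else [:: l1].

Definition select_string (s : seq bool) := flatten (map select_block (toggles false s)).

Lemma size_select_blocks (t : seq bool) :
  size (flatten (map select_block t)) = size t + count id t.
Proof. by elim: t => //= -[] t IH; rewrite size_cat IH /=; lia. Qed.

Lemma count_select_blocks (t : seq bool) :
  count_mem l1 (flatten (map select_block t)) = size t.
Proof. by elim: t => //= -[] t IH; rewrite count_cat IH. Qed.

Lemma runs_select_string s : runs (select_string s) <= (runs s).*2.+1.
Proof.
rewrite /select_string; apply: (@leq_trans (count id (toggles false s)).*2.+1); last first.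
  by rewrite ltnS leq_double count_toggles.
have key t : changes l1 (flatten (map select_block t)) <= (count id t).*2.
  by elim: t => //= -[] t IH /=; lia.
move: (toggles false s) => [|b t] //=; have := key t; case: b => /=; lia.
Qed.

Lemma select_string_split s u : u < size s ->
  exists s1 s2, [/\ select_string s = s1 ++ l1 :: s2,
    size s1 = u + count id (take u.+1 (toggles false s)) & count_mem l1 s1 = u].
Proof.
move=> hu; have ht : u < size (toggles false s) by rewrite size_toggles.
rewrite /select_string; move: (toggles false s) ht => t ht.
rewrite -{1}(cat_take_drop u t) (drop_nth false) // map_cat flatten_cat /=.
rewrite (take_nth false) // -cats1 count_cat /= addn0.
have sz : size (take u t) = u by rewrite size_take ht.
exists (flatten (map select_block (take u t)) ++ (if nth false t u then [:: l0] else [::])).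
exists (flatten (map select_block (drop u.+1 t))); split.
- by rewrite -catA; case: nth.
- by rewrite size_cat size_select_blocks sz; case: nth => /=; lia.
- by rewrite count_cat count_select_blocks sz; case: nth => /=; lia.
Qed.

End BinaryStrings.

Lemma nth_flatten_uniform (T : Type) (x0 : T) N (ss : seq (seq T)) i j :
  all (fun s => size s == N) ss -> j < N -> i < size ss ->
  nth x0 (flatten ss) (i * N + j) = nth x0 (nth [::] ss i) j.
Proof.
move=> + jN; elim: ss i => //= s ss IH [|i] /andP[/eqP sN all_ss] hi; rewrite nth_cat sN.
  by rewrite mul0n jN.
by rewrite ltnNge mulSn -addnA leq_addr addKn IH.
Qed.

Lemma size_flatten_uniform (T : Type) N (ss : seq (seq T)) :
  all (fun s => size s == N) ss -> size (flatten ss) = size ss * N.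
Proof. by elim: ss => //= s ss IH /andP[/eqP sN /IH]; rewrite size_cat sN mulSn => ->. Qed.

Section OrdConcat.
Variables (T : eqType) (x0 : T) (k N : nat) (F : 'I_k -> seq T).
Hypothesis sizeF : forall i, size (F i) = N.

Definition ord_concat := flatten [seq F i | i <- enum 'I_k].

Let allN : all (fun s => size s == N) [seq F i | i <- enum 'I_k].
Proof. by rewrite all_map; apply/allP => i _ /=; rewrite sizeF. Qed.

Lemma size_ord_concat : size ord_concat = k * N.
Proof. by rewrite (size_flatten_uniform allN) size_map size_enum_ord. Qed.

Lemma nth_ord_concat (i : 'I_k) j : j < N -> nth x0 ord_concat (i * N + j) = nth x0 (F i) j.
Proof.
have sz : size [seq F i | i <- enum 'I_k] = k by rewrite size_map size_enum_ord.
move=> jN; rewrite (nth_flatten_uniform _ allN) ?sz //.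
by rewrite (nth_map i) ?size_enum_ord // nth_ord_enum.
Qed.

Lemma runs_ord_concat R : (forall i, runs (F i) <= R) -> runs ord_concat <= k * R.
Proof.
move=> hR; apply: leq_trans (runs_flatten _) _.
rewrite -[X in _ <= X * _](size_enum_ord k); elim: (enum 'I_k) => //= i s IH.
by rewrite mulSn leq_add.
Qed.

End OrdConcat.

(** The truth table of [f d] as a bit string; the order [pos] of the queries is common to all [d]
    and has to keep runs few. *)
Record bit_spec (V D : finType) (f : D -> V -> bool) (bits : D -> seq bool)
    (pos : V -> nat) (R : nat) : Prop := BitSpec {
  pos_lt : forall v, pos v < #|V|;
  pos_inj : injective pos;
  size_bits : forall d, size (bits d) = #|V|;
  nth_bits : forall d v, nth false (bits d) (pos v) = f d v;
  runs_bits_le : forall d, runs (bits d) <= R }.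

Lemma mulnD_inj N a b a' b' : b < N -> b' < N -> a * N + b = a' * N + b' -> a = a' /\ b = b'.
Proof.
move=> hb hb' e; have N0 : 0 < N by apply: leq_trans hb.
have divN c d : d < N -> (c * N + d) %/ N = c by move=> ?; rewrite divnMDl // divn_small // addn0.
have ea : a = a' by rewrite -(divN a b hb) e divN.
by split=> //; move: e; rewrite ea => /addnI.
Qed.

(** In lexicographic order a top block repeats each bit of the inner table [N] times, which creates
    no run, and a bottom block puts the inner table at slot [x0] between two constant stretches. The
    length is squared, yet only 2 runs are added. *)
Lemma bit_spec_step (V D : finType) (f : D -> V -> bool) h bits pos R :
  bit_spec f bits pos R ->
  exists bits' pos', bit_spec (stepf f (h := h)) bits' pos' (h * R + 2).
Proof.
move=> [plt pinj sb nb rb].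
pose N := h * #|V|.
pose posX (x : halfV V h) := x.1 * #|V| + pos x.2.
have pXlt x : posX x < N.
  apply: (@leq_trans (x.1.+1 * #|V|)); first by rewrite mulSnr ltn_add2l plt.
  by rewrite leq_mul2r ltn_ord orbT.
have pXinj : injective posX.
  move=> [z v] [z' v'] /mulnD_inj[] // /= => [/val_inj -> /pinj ->//].
pose inner (e : {ffun 'I_h -> D}) := ord_concat (fun z => bits (e z)).
have si e : size (inner e) = N by exact: size_ord_concat.
have ni e x : nth false (inner e) (posX x) = f (e x.1) x.2.
  by rewrite /inner /posX (nth_ord_concat false (fun z => sb (e z))) // nb.
have ri e : runs (inner e) <= h * R by apply: runs_ord_concat => z.
pose bits' (d : stepD V D h) : seq bool :=
  let: (top, x0, e) := d in
  if top then flatten [seq nseq N a | a <- inner e]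
  else nseq (posX x0 * N) false ++ inner e ++ nseq ((N - (posX x0).+1) * N) false.
pose pos' (u : stepV V h) := posX u.1 * N + posX u.2.
have allN e : all (fun s => size s == N) [seq nseq N a | a <- inner e].
  by rewrite all_map; apply/allP => a _ /=; rewrite size_nseq.
have cV : #|stepV V h| = N * N by rewrite !card_prod card_ord.
exists bits', pos'; split.
- move=> [x y]; rewrite cV /pos' /=; apply: (@leq_trans ((posX x).+1 * N)).
    by rewrite mulSnr ltn_add2l.
  by rewrite leq_mul2r pXlt orbT.
- by move=> [x y] [x' y'] /mulnD_inj[] // /= => [/pXinj -> /pXinj ->].
- move=> [[top x0] e]; rewrite cV /bits'; case: top.
    by rewrite (size_flatten_uniform (allN e)) size_map si.
  rewrite !size_cat !size_nseq si addnA -mulSnr -mulnDl; congr (_ * _).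
  by have := pXlt x0; lia.
- move=> [[top x0] e] [x y]; rewrite /bits' /pos' /stepf /=; case: top.
    rewrite (nth_flatten_uniform _ (allN e)) ?size_map ?si //.
    by rewrite (nth_map false) ?si // nth_nseq pXlt ni.
  rewrite nth_cat size_nseq nth_cat si !nth_nseq.
  case: (x =P x0) => [->|ne].
    by rewrite ltnNge leq_addr /= addKn pXlt ni.
  rewrite !if_same; case: ifP => // h1; case: ifP => // h2; exfalso; apply: ne; apply: pXinj.
  have := pXlt y; move: (posX x) (posX x0) (posX y) h1 h2 => a a0 c.
  move/negbT; rewrite -leqNgt => h1 h2 h3.
  have h4 : a * N + c < a0.+1 * N by rewrite mulSn; lia.
  have h5 : a < a0.+1 by rewrite -(ltn_pmul2r (_ : 0 < N)); lia.
  have h6 : a0 < a.+1 by rewrite -(ltn_pmul2r (_ : 0 < N)) ?mulSn; lia.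
  by lia.
- move=> [[top x0] e]; rewrite /bits'; case: top.
    by apply: leq_trans (runs_stretch _ _) _; apply: leq_trans (ri e) _; lia.
  apply: leq_trans (runs_cat _ _) (leq_trans (leq_add (runs_nseq _ _) _) _).
    exact: leq_trans (runs_cat _ _) (leq_add (ri e) (runs_nseq _ _)).
  by lia.
Qed.

(** The [- 1] closes the induction: [h * (2 * m - 1) + 2 <= 2 * h * m - 1] once [h] is at least
    3. *)
Lemma hard_bit_spec b G t : 2 < b -> 0 < G ->
  let h := fun s => b ^ (G * 2 ^ s) in
  exists bits pos, bit_spec (@hardf h t) bits pos (2 * b ^ (G * (2 ^ t).-1) - 1).
Proof.
move=> b2 G0 h; elim: t => [|t [bits [pos IH]]].
  exists (fun d => [:: d : bool]), (fun=> 0); split=> //=; first by rewrite card_unit.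
  - by move=> [] [].
  - by rewrite card_unit.
  - by rewrite muln0.
have [bits' [pos' [h1 h2 h3 h4 h5]]] := bit_spec_step (h t) IH.
exists bits', pos'; split => // d; apply: leq_trans (h5 d) _.
have -> : b ^ (G * (2 ^ t.+1).-1) = h t * b ^ (G * (2 ^ t).-1).
  have : 0 < 2 ^ t by rewrite expn_gt0.
  by rewrite -expnD expnS => ?; congr (b ^ _); rewrite -mulnDr; congr (G * _); lia.
have b0 : 0 < b by apply: ltn_trans b2.
have m0 : 0 < b ^ (G * (2 ^ t).-1) by rewrite expn_gt0 b0.
have ht : 2 < h t.
  rewrite /h; apply: leq_trans b2 _; rewrite -{1}(expn1 b) leq_pexp2l //.
  by rewrite muln_gt0 G0 expn_gt0.
by move: (b ^ _) (h t) m0 ht => m g; nia.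
Qed.

(** * Reductions *)

Section Advice.
Variables (w S : nat) (Z Y : finType) (A : Type).

(** Words are tagged by the part of memory they come from; with [with_table_mem] the branch for a
    wrong tag is never taken. *)
Fixpoint with_table (post : A -> bool) (t : probe_tree w S A) :
    ptree ('I_S + Z)%type (w.-tuple bool + Y)%type bool :=
  match t with
  | Answer a => PAnswer _ _ (post a)
  | Probe j next => PProbe (inl j) (fun x =>
      if x is inl y then with_table post (next y) else PAnswer _ _ false)
  end.

Definition with_table_mem (m : {ffun 'I_S -> w.-tuple bool}) (tab : Z -> Y)
    (c : 'I_S + Z) : w.-tuple bool + Y :=
  match c with inl j => inl (m j) | inr z => inr (tab z) end.

Lemma with_table_correct post t m tab :
  pdepth (with_table post t) (with_table_mem m tab) = nprobes t m /\
  prun (with_table post t) (with_table_mem m tab) = post (run t m).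
Proof. by elim: t => //= j next IH; have [-> ->] := IH (m j). Qed.

End Advice.

(** [hard_not_solvable] asks for [T + 6]; the 3 extra powers of [b] pay for the redundancy of the
    structure in [space_bound]. *)
Definition hard_arity (b T s : nat) : nat := b ^ ((T + 9) * 2 ^ s).

(** If every query used fewer than [T] probes, a preliminary probe for the table entry from which
    the query is formed would still fit into the [T] probes excluded by [hard_not_solvable], applied
    to the full family. *)
Lemma exists_slow_query (X Q A : Type) (f : Q -> X -> A) (w S : nat)
    (D : data_structure w S f) (I Z Y : finType) (b w' l T : nat) :
  let h := hard_arity b T in
  forall (B : {ffun I -> hardD h T} -> X) (tab : {ffun I -> hardD h T} -> Z -> Y)
    (slot : I -> hardV h T -> Z) (q : I -> hardV h T -> Y -> Q)
    (post : I -> hardV h T -> A -> bool),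
  (forall d i u, post i u (f (q i u (tab d (slot i u))) (B d)) = hardf (d i) u) ->
  2 ^ w + #|Y| <= 2 ^ w' -> 2 + w' + 4 * w' * l.+1 <= b -> 512 * 64 ^ T <= b ->
  b <= #|I| -> (S + #|Z|).+1 <= #|I| * b ^ ((T + 9) * 2 ^ T - 6 - T) ->
  #|I| * #|hardV h T| <= 2 ^ l ->
  exists x q, T <= query_time D x q.
Proof.
move=> h B tab slot q post hpost hY hb1 hb2 hI hN hl.
apply: contrapT => /forallNP hx.
have {}hx x q0 : query_time D x q0 < T.
  by rewrite ltnNge; apply/negP => le; apply: (hx x); exists q0.
have := @hard_not_solvable ('I_S + Z)%type (w.-tuple bool + Y)%type I b (T + 9) w' l T T 0 1
  setT (fun=> setT).
apply=> //; first by rewrite card_sum card_tuple card_bool.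
- by rewrite leq_add2l.
- by rewrite mul1n.
- by rewrite card_sum card_ord.
- by rewrite cardsT card_ffun muln1.
- by move=> i; rewrite cardsT muln1.
exists (fun d => with_table_mem (encode D (B d)) (tab d)).
exists (fun i u => PProbe (inr (slot i u)) (fun x =>
  if x is inr y then with_table Z Y (post i u) (algorithm D (q i u y))
  else PAnswer _ _ false)) => d _ i u _ /=.
have [-> ->] := with_table_correct (post i u) (algorithm D (q i u (tab d (slot i u))))
  (encode D (B d)) (tab d).
split; first exact: hx.
by rewrite -hpost; case: (D) => enc alg correct /=; rewrite correct.
Qed.

(** Rounds [8 * m * v * b] up to a multiple of one power of [b], where a block has [v] positions and
    fewer than [2 * m] runs. It serves as lower bound for [r] and for [n / r] or the alphabet. *)
Definition hard_threshold (b T : nat) : nat := 16 * b ^ ((T + 9) * T.+1 * 2 ^ T).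

Section Threshold.
Variables (b T : nat).
Hypothesis b16 : 16 <= b.

Let m := b ^ ((T + 9) * (2 ^ T).-1).
Let v := b ^ ((T + 9) * T * 2 ^ T).
Let b0 : 0 < b. Proof. exact: leq_trans b16. Qed.
Let T2 : 0 < 2 ^ T. Proof. by rewrite expn_gt0. Qed.

Lemma hard_threshold_ge : 8 * m * v * b <= hard_threshold b T.
Proof.
rewrite /hard_threshold -!mulnA; apply: leq_mul => //.
rewrite -expnSr -expnD leq_pexp2l // -!mulnA addnS -mulnDr.
have : (T + 9) * ((2 ^ T).-1 + T * 2 ^ T).+1 <= (T + 9) * (T.+1 * 2 ^ T).
  by rewrite leq_mul2l mulSn; apply/orP; right; lia.
by apply: leq_trans; rewrite mulnS mulnDr; lia.
Qed.

Lemma space_bound k r s : 0 < r -> r <= 16 * m * k -> s <= r * b + r + 1 ->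
  s <= k * b ^ ((T + 9) * 2 ^ T - 6 - T).
Proof.
move=> r0 hr hs.
have -> : (T + 9) * 2 ^ T - 6 - T = (T + 9) * (2 ^ T).-1 + 3.
  by move: (2 ^ T) T2 => [//|x] _ /=; rewrite mulnS; clear; move: (_ * x) => y; lia.
rewrite expnD -/m.
have h1 : s <= r * (b * b).
  apply: leq_trans hs _; apply: (@leq_trans (r * (b + 2))); first by rewrite mulnDr; clear -r0; lia.
  by rewrite leq_mul2l; apply/orP; right; clear -b16; nia.
apply: leq_trans h1 (leq_trans (leq_mul hr (leqnn _)) _).
rewrite (_ : b ^ 3 = b * (b * b)); last by rewrite !expnS muln1.
rewrite (_ : k * (m * (b * (b * b))) = b * m * k * (b * b)); last by clear; lia.
by rewrite !leq_mul.
Qed.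

End Threshold.

Lemma exists_hard_strings k b T : 16 <= b ->
  let h := hard_arity b T in
  exists (s : ('I_k -> hardD h T) -> seq bool) (pos : 'I_k -> hardV h T -> nat),
  [/\ forall d, size (s d) = k * b ^ ((T + 9) * T * 2 ^ T),
      forall d, runs (s d) <= k * (2 * b ^ ((T + 9) * (2 ^ T).-1)),
      forall i u, pos i u < k * b ^ ((T + 9) * T * 2 ^ T)
    & forall d i u, nth false (s d) (pos i u) = hardf (d i) u].
Proof.
move=> b16 h.
have [||bits [pos [plt _ sb nb rb]]] := @hard_bit_spec b (T + 9) T; [exact: leq_trans b16|lia|].
rewrite card_hardV in plt sb.
exists (fun d => ord_concat (fun i => bits (d i))).
exists (fun i u => i * b ^ ((T + 9) * T * 2 ^ T) + pos u); split.
- by move=> d; apply: size_ord_concat.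
- move=> d; apply: runs_ord_concat => i; apply: leq_trans (rb _) _; exact: leq_subr.
- move=> i u; apply: (@leq_trans (i.+1 * b ^ ((T + 9) * T * 2 ^ T))).
    by rewrite mulSnr ltn_add2l.
  by rewrite leq_mul2r ltn_ord orbT.
- by move=> d i u; rewrite (nth_ord_concat false (fun z => sb (d z))) // nb.
Qed.

Lemma exists_slow_binary_query n sigma r w S b l T (Q A : Type)
    (f : Q -> run_string n sigma.+2 r -> A) (D : data_structure w S f)
    (enc : seq bool -> seq 'I_sigma.+2) (q : nat -> Q) (post : nat -> A -> bool) :
  (forall s, 0 < size s -> 0 < size (enc s) <= size s + runs s) ->
  (forall s, runs (enc s) <= (runs s).*2.+1) ->
  (forall s (B : run_string n sigma.+2 r) p u, u < size s -> u < n ->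
    tval (val B) = enc s ++ p -> post u (f (q u) B) = nth false s u) ->
  hard_threshold b T <= r -> hard_threshold b T * r <= n -> n * n <= 2 ^ l ->
  S <= r * b -> 2 + w.+1 + 4 * w.+1 * l.+1 <= b -> 512 * 64 ^ T <= b ->
  exists B q, T <= query_time D B q.
Proof.
move=> henc1 henc2 hpost hF hFn hn hS hb1 hb2.
have b16 : 16 <= b by apply: leq_trans hb2; rewrite -[16]muln1 leq_mul // expn_gt0.
have b0 : 0 < b by apply: leq_trans b16.
pose m := b ^ ((T + 9) * (2 ^ T).-1); pose v := b ^ ((T + 9) * T * 2 ^ T).
have [m0 v0] : 0 < m /\ 0 < v by rewrite !expn_gt0 b0.
have hF' := hard_threshold_ge T b16; rewrite -/m -/v in hF'.
(* An encoded string has at most [4 * k * m + 1] runs, which must not exceed [r]. *)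
pose k := r %/ (8 * m).
have kr : k * (8 * m) <= r by apply: leq_trunc_div.
have bk : b <= k.
  rewrite leq_divRL ?muln_gt0 //; apply: leq_trans hF; apply: leq_trans hF'.
  by rewrite mulnC leq_mul2r leq_pmulr ?orbT.
have k0 : 0 < k by apply: leq_trans bk.
have rk : r <= 16 * m * k.
  have : r < k.+1 * (8 * m) by rewrite ltn_ceil // muln_gt0.
  move=> /ltnW/leq_trans; apply; apply: (@leq_trans (k.*2 * (8 * m))); last by clear; lia.
  by rewrite leq_mul2r; apply/orP; right; lia.
have r0 : 0 < r by apply: leq_trans kr; rewrite !muln_gt0 k0.
have mk : 0 < k * m by rewrite muln_gt0 k0.
(* The blocks occupy at most [v * r] positions; the rest is room for the growth under [enc] and for
   padding. *)
have v2r : (v + 2) * r <= n.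
  apply: leq_trans hFn; rewrite leq_mul2r; apply/orP; right; apply: leq_trans hF'.
  have : v * 8 * 1 <= v * 8 * (m * b) by rewrite leq_mul2l muln_gt0 m0 b0 orbT.
  by rewrite (_ : 8 * m * v * b = v * 8 * (m * b)); [lia|clear; lia].
have kvr : k * v <= r * v by rewrite leq_mul2r; apply/orP; right; clear -kr m0; nia.
have [s [pos [ss rs plt npos]]] := exists_hard_strings k T b16.
rewrite -/m -/v in ss rs plt.
have /boolp.choice[B hB] : forall d : {ffun 'I_k -> hardD (hard_arity b T) T},
    exists (B : run_string n sigma.+2 r) p, tval (val B) = enc (s d) ++ p.
  move=> d; have := rs d; have := ss d => sd rd.
  have /andP[e1 e2] : 0 < size (enc (s d)) <= size (s d) + runs (s d).
    by apply: henc1; rewrite sd muln_gt0 k0.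
  apply: exists_run_string => //.
    by apply: leq_trans (henc2 _) _; move: rd; clear -kr mk; lia.
  by move: e2; rewrite sd; move: v2r kvr rd; clear -kr; lia.
apply: (@exists_slow_query _ _ _ _ _ _ D 'I_k unit unit b w.+1 l T B (fun _ _ => tt)
  (fun _ _ => tt) (fun i u _ => q (pos i u)) (fun i u => post (pos i u))) => //.
- move=> d i u; have [p hp] := hB d; rewrite -npos; apply: hpost hp; first by rewrite ss plt.
  by apply: leq_trans (plt i u) _; apply: leq_trans kvr _; move: v2r; clear; lia.
- by rewrite card_unit expnS; have : 0 < 2 ^ w; [rewrite expn_gt0|lia].
- by rewrite card_ord.
- rewrite card_ord card_unit; apply: (space_bound b16 r0 rk).
  by rewrite addn1; move: hS; clear -r0; lia.
- rewrite card_ord card_hardV -/v; apply: leq_trans hn; apply: (@leq_trans n).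
    by apply: leq_trans kvr _; move: v2r; clear; lia.
  by rewrite leq_pmulr //; move: v2r; clear -r0; nia.
Qed.

Section BinaryProblems.
Variables (n sigma r w S b l T : nat).
Hypotheses (hF : hard_threshold b T <= r) (hFn : hard_threshold b T * r <= n)
  (hn : n * n <= 2 ^ l) (hS : S <= r * b) (hw : 2 + w.+1 + 4 * w.+1 * l.+1 <= b)
  (hT : 512 * 64 ^ T <= b).

Let n0 : 0 < n.
Proof.
have b0 : 0 < b by apply: leq_trans hw.
have F0 : 0 < hard_threshold b T by rewrite muln_gt0 expn_gt0 b0.
by apply: leq_trans hFn; rewrite muln_gt0 F0 (leq_trans F0).
Qed.

Lemma access_slow_query (D : data_structure w S (@access_problem n sigma.+2 r)) :
  exists B i, T <= query_time D B i.
Proof.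
have n1 := prednK n0.
pose q u : 'I_n := cast_ord n1 (inord u).
apply: (@exists_slow_binary_query _ _ _ _ _ b l T _ _ _ D
  (map (@bit_letter sigma)) q (fun _ a => a == lift ord0 ord0) _ _ _ hF hFn hn hS hw hT).
- by move=> s s0; rewrite size_map s0 leq_addr.
- by move=> s; apply: leq_trans (runs_map _ _) _; lia.
move=> s B p u us un Bs; rewrite /access_problem.
have qu : q u = u :> nat by rewrite /= inordK // n1.
rewrite (access_prefix Bs ord0) ?size_map ?qu // (nth_map false) //.
by case: nth.
Qed.

Lemma binary_rank_slow_query (D : data_structure w S (@rank_problem n sigma.+2 r)) :
  exists B q, T <= query_time D B q.
Proof.
have n1 := prednK n0.
pose q u : 'I_sigma.+2 * 'I_n := (lift ord0 ord0, cast_ord n1 (inord u)).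
apply: (@exists_slow_binary_query _ _ _ _ _ b l T _ _ _ D
  (@rank_string sigma) q (fun _ a => odd a) _ _ _ hF hFn hn hS hw hT).
- by move=> s s0; rewrite size_map size_toggles s0 leq_addr.
- exact: runs_rank_string.
move=> s B p u us un Bs; rewrite /rank_problem /=.
have qu : (q u).2 = u :> nat by rewrite /= inordK // n1.
rewrite (rank_prefix Bs) ?size_map ?size_toggles ?qu //.
by rewrite count_rank_string odd_count_toggles.
Qed.

Lemma select_slow_query (D : data_structure w S (@select_problem n sigma.+2 r)) :
  exists B q, T <= query_time D B q.
Proof.
pose q u : 'I_sigma.+2 * int := (lift ord0 ord0, Posz u.+1).
apply: (@exists_slow_binary_query _ _ _ _ _ b l T _ _ _ D
  (@select_string sigma) q (fun u a => if a is Posz j then odd j (+) odd u else false) _ _ _ hF hFn hn hS hw hT).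
- move=> s s0; rewrite size_select_blocks size_toggles leq_add2l count_toggles andbT.
  by rewrite addn_gt0 s0.
- exact: runs_select_string.
move=> s B p u us un Bs; rewrite /select_problem /=.
have [s1 [s2 [e1 e2 e3]]] := select_string_split sigma us.
have := @select_split _ _ (val B) (lift ord0 ord0) s1 (s2 ++ p).
rewrite e3 Bs e1 -catA /q /= => -> //.
by rewrite e2 oddD odd_count_toggles // addbC addbA addbb.
Qed.

End BinaryProblems.

(** * Rank over large alphabets *)

Section AlternatingString.
Variable sigma : nat.
Implicit Types (cs : seq 'I_sigma.+1).

(** The separator [ord0] makes the number of runs depend on the length of [cs] alone. *)
Definition alternating cs : seq 'I_sigma.+2 :=
  ord0 :: flatten [seq [:: lift ord0 c; ord0] | c <- cs].

Lemma size_alternating cs : size (alternating cs) = (size cs).*2.+1.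
Proof. by congr _.+1; elim: cs => //= c cs ->. Qed.

Lemma runs_alternating cs : runs (alternating cs) = (size cs).*2.+1.
Proof. by congr _.+1; elim: cs => //= c cs ->. Qed.

Lemma count_alternating c cs : count_mem (lift ord0 c) (alternating cs) = count_mem c cs.
Proof. by rewrite /=; elim: cs => //= c' cs; rewrite (inj_eq lift_inj) => /= <-. Qed.

Lemma take_alternating cs1 cs2 :
  take (size cs1).*2.+1 (alternating (cs1 ++ cs2)) = alternating cs1.
Proof.
rewrite -size_alternating /alternating map_cat flatten_cat -cat_cons.
by rewrite take_size_cat.
Qed.

End AlternatingString.

Section Emission.
Variables (v : nat) (tg : 'I_v -> seq bool).

(** All sequences [tg c] run on a common clock: the number of letters [c] emitted before a given
    time counts the ones of [tg c], whatever the other letters do. *)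
Definition emission_at u : seq 'I_v := [seq c <- enum 'I_v | nth false (tg c) u].

Definition emission m : seq 'I_v := flatten [seq emission_at u | u <- iota 0 m].

Lemma emissionS m : emission m.+1 = emission m ++ emission_at m.
Proof. by rewrite /emission -addn1 iotaD map_cat flatten_cat /= cats0. Qed.

Lemma count_emission c m : m <= size (tg c) -> count_mem c (emission m) = count id (take m (tg c)).
Proof.
elim: m => [|m IH] hm; first by rewrite take0.
rewrite emissionS count_cat IH 1?ltnW // (take_nth false) // -cats1 count_cat /= addn0.
congr (_ + _); rewrite /emission_at count_filter.
case e: (nth false (tg c) m).
  rewrite (eq_count (a2 := pred1 c)); last by move=> c' /=; case: (c' =P c) => // ->; rewrite e.
  by rewrite count_uniq_mem ?enum_uniq // mem_enum.
rewrite (eq_count (a2 := pred0)) ?count_pred0 //.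
by move=> c' /=; case: (c' =P c) => // ->; rewrite e.
Qed.

Lemma size_emission m : size (emission m) = \sum_c count_mem c (emission m).
Proof.
elim: (emission m) => [|c s IH] /=; first by rewrite big1.
by rewrite big_split /= -IH (bigD1 c) //= eqxx big1 // => c' /negbTE; rewrite eq_sym => ->.
Qed.

Lemma emission_prefix m k : m <= k -> exists s, emission k = emission m ++ s.
Proof.
elim: k => [|k IH]; first by rewrite leqn0 => /eqP ->; exists [::].
rewrite leq_eqVlt ltnS => /orP[/eqP ->|/IH[s es]]; first by exists [::]; rewrite cats0.
by exists (s ++ emission_at k); rewrite emissionS es catA.
Qed.

End Emission.

(** Each of [v] letters carries [k1] blocks in succession, on a clock of [k = k1 * v] times. Where a
    time ends in the string depends on the data, so a table indexed by time supplies it. With [v]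
    letters, [k] is also the number of blocks, and the table costs one cell per block. *)
Lemma rank_slow_query n sigma r w S b l T
    (D : data_structure w S (@rank_problem n sigma.+2 r)) :
  hard_threshold b T <= r -> hard_threshold b T <= sigma.+2 -> r <= n -> n * n <= 2 ^ l ->
  S <= r * b -> 2 + (w + l).+1 + 4 * (w + l).+1 * l.+1 <= b -> 512 * 64 ^ T <= b ->
  exists B q, T <= query_time D B q.
Proof.
move=> hF hFs rn hn hS hb1 hb2.
have b16 : 16 <= b by apply: leq_trans hb2; rewrite -[16]muln1 leq_mul // expn_gt0.
have b0 : 0 < b by apply: leq_trans b16.
pose m := b ^ ((T + 9) * (2 ^ T).-1); pose v := b ^ ((T + 9) * T * 2 ^ T).
have [m0 v0] : 0 < m /\ 0 < v by rewrite !expn_gt0 b0.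
have hF' := hard_threshold_ge T b16; rewrite -/m -/v in hF'.
have mvb : 8 * m * v * b <= r by apply: leq_trans hF.
pose k1 := r %/ (8 * m * v); pose k := k1 * v.
have c0 : 0 < 8 * m * v by rewrite !muln_gt0 m0.
have kr : k1 * (8 * m * v) <= r by apply: leq_trunc_div.
have bk : b <= k1 by rewrite leq_divRL // mulnC.
have k0 : 0 < k1 by apply: leq_trans bk.
have rk : r <= 16 * m * k.
  have : r < k1.+1 * (8 * m * v) by rewrite ltn_ceil.
  move=> /ltnW/leq_trans; apply; apply: (@leq_trans (k1.*2 * (8 * m * v))); last by rewrite /k; clear; lia.
  by rewrite leq_mul2r; apply/orP; right; lia.
have r0 : 0 < r by apply: leq_trans kr; rewrite muln_gt0 k0.
have vs : v <= sigma.+1.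
  have : v * 8 * 1 <= v * 8 * (m * b) by rewrite leq_mul2l muln_gt0 m0 b0 orbT.
  have : v * 8 * (m * b) <= sigma.+2.
    by apply: leq_trans hFs; apply: leq_trans hF'; rewrite (_ : v * 8 * (m * b) = 8 * m * v * b) //; clear; lia.
  by move: v0; clear; lia.
have vr : v <= r by apply: leq_trans mvb; rewrite mulnAC leq_pmull // !muln_gt0 m0 b0.
have kmr : 8 * (k * m) <= r by apply: leq_trans kr; rewrite /k; clear; lia.
have kler : k <= r by apply: leq_trans kmr; move: m0; clear; nia.
have [s [pos [ss rs plt npos]]] := exists_hard_strings k1 T b16.
rewrite -/m -/v -/k in ss rs plt.
pose h := hard_arity b T.
pose I := ('I_k1 * 'I_v)%type : finType.
pose tg (d : {ffun I -> hardD h T}) (c : 'I_v) := toggles false (s (fun j => d (j, c))).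
have stg d c : size (tg d c) = k by rewrite size_toggles ss.
pose cs d u : seq 'I_sigma.+1 := [seq widen_ord vs c | c <- emission (tg d) u].
have size_cs d : size (cs d k) <= v * (k1 * (2 * m)).
  rewrite size_map size_emission -[X in X * _](card_ord v) -sum_nat_const.
  apply: leq_sum => c _; rewrite count_emission ?stg // -(stg d c) take_size.
  by apply: leq_trans (count_toggles _ _) (rs _).
have size_alt d : (size (cs d k)).*2.+1 <= r.
  have := size_cs d; have : 0 < k * m by rewrite !muln_gt0 k0 v0.
  by move: kmr; rewrite /k; clear; lia.
have pfx d u : u <= k -> exists s', cs d k = cs d u ++ s'.
  by move=> /(emission_prefix (tg d))[s' e]; exists [seq widen_ord vs c | c <- s']; rewrite /cs e map_cat.
have n0 : 0 < n by apply: leq_trans rn.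
have n1 := prednK n0.
have /boolp.choice[B hB] : forall d, exists (B : run_string n sigma.+2 r) p,
    tval (val B) = alternating (cs d k) ++ p.
  move=> d; apply: exists_run_string.
  - by rewrite size_alternating.
  - by rewrite runs_alternating.
  - by rewrite size_alternating runs_alternating subnKC.
(* [rank] includes its position, and [(size cs).*2] is the last index of [alternating cs]; [u.+1]
   because time [u] must be complete. *)
pose tab d (u : 'I_k) : 'I_n := cast_ord n1 (inord (size (cs d u.+1)).*2).
have tabE d u : tab d u = (size (cs d u.+1)).*2 :> nat.
  rewrite /= inordK // n1; apply: leq_trans rn; apply: leq_trans (size_alt d).
  by have [|s' ->] := pfx d u.+1; [|rewrite ltnS leq_double size_cat leq_addr].
apply: (@exists_slow_query _ _ _ _ _ _ D I 'I_k 'I_n b (w + l).+1 l T B tab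
  (fun i u => Ordinal (plt i.1 u)) (fun i _ y => (lift ord0 (widen_ord vs i.2), y))
  (fun _ _ a => odd a)) => //.
- move=> d [j c] u; have [p hp] := hB d; set u' := Ordinal _.
  have [|s' es'] := pfx d u'.+1; first exact: ltn_ord.
  rewrite /rank_problem /= (rank_prefix hp); last first.
    by rewrite size_alternating tabE ltnS leq_double es' size_cat leq_addr.
  rewrite tabE es' take_alternating count_alternating /cs count_map.
  rewrite (eq_count (a2 := pred1 c)); last by move=> c' /=; rewrite -val_eqE.
  rewrite count_emission ?stg ?ltn_ord //.
  rewrite odd_count_toggles ?ss ?plt //= npos //.
- rewrite card_ord expnS mul2n -addnn; apply: leq_add.
    by rewrite leq_pexp2l // leq_addr.
  apply: leq_trans (_ : n * n <= _); first by rewrite leq_pmulr.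
  by apply: leq_trans hn _; rewrite leq_pexp2l // leq_addl.
- by rewrite card_prod !card_ord; apply: leq_trans bk _; rewrite leq_pmulr.
- rewrite card_prod !card_ord; apply: (space_bound b16 r0 rk).
  by move: hS kler; clear; lia.
- rewrite card_prod !card_ord card_hardV -/v -/k; apply: leq_trans hn.
  by rewrite leq_mul // (leq_trans _ rn).
Qed.

(** * Space needed for rank, and the need for one probe *)

Lemma rank_inj n sigma (B B' : n.-tuple 'I_sigma) :
  (forall c i, rank c i B = rank c i B') -> B = B'.
Proof.
move=> h; apply: eq_from_tnth => i; pose c := tnth B i.
have h' : count_mem c (take i B) = count_mem c (take i B').
  case: i @c => -[|i] hi c; first by rewrite !take0.
  by have := h c (Ordinal (ltnW hi)).
have := h c i; rewrite /rank !(take_nth c) ?size_tuple //.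
rewrite -!cats1 !count_cat h' => /addnI /=; rewrite !addn0 -!tnth_nth eqxx.
by case: eqP => // ->.
Qed.

(** Rank answers determine the string, and alternating strings have [r.-1./2] free letters. This
    limits the alphabet, whose size is not bounded in terms of [n] beforehand. *)
Lemma rank_space_bound n sigma r w S (D : data_structure w S (@rank_problem n sigma.+2 r)) :
  0 < r -> r <= n -> sigma.+1 ^ (r.-1./2) <= 2 ^ (S * w).
Proof.
move=> r0 rn; pose m := r.-1./2.
have mr : m.*2.+1 <= r by have := odd_double_half r.-1; rewrite /m; lia.
have /boolp.choice[B hB] : forall cs : m.-tuple 'I_sigma.+1,
    exists (B : run_string n sigma.+2 r) p, tval (val B) = alternating cs ++ p.
  move=> cs; apply: exists_run_string.
  - by rewrite size_alternating.
  - by rewrite runs_alternating size_tuple.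
  - by rewrite size_alternating runs_alternating size_tuple subnKC.
have injB : injective (fun cs => encode D (B cs)).
  move=> cs cs' e; have eB : val (B cs) = val (B cs').
    apply: rank_inj => c i; move: e; case: (D) => enc alg correct /= e.
    by have := correct (B cs) (c, i); rewrite e correct.
  have [p hp] := hB cs; have [p' hp'] := hB cs'.
  apply: val_inj => /=; move: hp; rewrite eB hp' => /(congr1 (take m.*2.+1)).
  rewrite !take_size_cat ?size_alternating ?size_tuple // /alternating => -[].
  elim: (tval cs') (tval cs) => [|c s IH] [|c' s'] //= [/val_inj -> /IH ->] //.
have := leq_card _ injB; rewrite card_tuple card_ord card_ffun card_tuple card_bool card_ord.
by rewrite -expnM mulnC.
Qed.

(** Without a probe an answer cannot depend on the string. This settles the range where the claimed
    bound is at most 1. *)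
Lemma exists_probing_query (X Q A : Type) (f : Q -> X -> A) (w S : nat)
    (D : data_structure w S f) (x x' : X) (q : Q) :
  f q x <> f q x' -> exists x q, 0 < query_time D x q.
Proof.
move=> ne; exists x, q; rewrite lt0n; apply/eqP => e; apply: ne.
move: e; rewrite /query_time; case: (D) => enc alg correct /=.
by rewrite -!correct; case: (alg q).
Qed.

Section Nontrivial.
Variables (n sigma r w S : nat).
Hypotheses (r2 : 2 <= r) (rn : r <= n).
Let n0 : 0 < n. Proof. by apply: leq_trans rn; apply: leq_trans r2. Qed.

Let prefixed a : exists (B : run_string n sigma.+2 r) p, tval (val B) = [:: a; other a] ++ p.
Proof.
have e : runs [:: a; other a] = 2 by rewrite /= other_neq.
by apply: exists_run_string; rewrite ?e // subnKC.
Qed.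

Lemma access_probing_query (D : data_structure w S (@access_problem n sigma.+2 r)) :
  exists B i, 0 < query_time D B i.
Proof.
have [B [p hB]] := prefixed ord0; have [B' [p' hB']] := prefixed (other ord0).
apply: (@exists_probing_query _ _ _ _ _ _ D B B' (Ordinal n0)).
by rewrite /access_problem (access_prefix hB ord0) // (access_prefix hB' ord0).
Qed.

Lemma rank_probing_query (D : data_structure w S (@rank_problem n sigma.+2 r)) :
  exists B q, 0 < query_time D B q.
Proof.
have [B [p hB]] := prefixed ord0; have [B' [p' hB']] := prefixed (other ord0).
apply: (@exists_probing_query _ _ _ _ _ _ D B B' (ord0, Ordinal n0)).
by rewrite /rank_problem (rank_prefix hB) // (rank_prefix hB').
Qed.

Lemma select_probing_query (D : data_structure w S (@select_problem n sigma.+2 r)) :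
  exists B q, 0 < query_time D B q.
Proof.
have [B [p hB]] := prefixed ord0; have [B' [p' hB']] := prefixed (other ord0).
apply: (@exists_probing_query _ _ _ _ _ _ D B B' (ord0, Posz 1)).
have := @select_split _ _ (val B) ord0 [::] (other ord0 :: p) hB.
have := @select_split _ _ (val B') ord0 [:: other ord0] p' hB'.
by rewrite /select_problem /= => -> ->.
Qed.

End Nontrivial.

(** * Asymptotics *)

Import Order.TTheory GRing.Theory Num.Theory.
Local Open Scope ring_scope.

Section Log2.
Variable R : realType.
Implicit Types (x y : R).

Lemma ln2_gt0 : 0 < ln (2 : R).
Proof. by rewrite ln_gt0 // ltr1n. Qed.

Lemma log2K x : 0 < x -> 2 `^ log2 x = x.
Proof.
move=> x0; rewrite /log2 /powR gt_eqF // divfK ?gt_eqF ?ln2_gt0 //.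
by rewrite lnK // posrE.
Qed.

Lemma powR2K y : log2 (2 `^ y) = y.
Proof. by rewrite /log2 ln_powR mulfK // gt_eqF ?ln2_gt0. Qed.

Lemma ler_log2 x y : 0 < x -> x <= y -> log2 x <= log2 y.
Proof.
move=> x0 xy; rewrite /log2 ler_pM2r ?invr_gt0 ?ln2_gt0 //.
by rewrite ler_ln ?posrE // (lt_le_trans x0).
Qed.

Lemma log2M x y : 0 < x -> 0 < y -> log2 (x * y) = log2 x + log2 y.
Proof. by move=> x0 y0; rewrite /log2 lnM ?posrE // mulrDl. Qed.

Lemma log2_div x y : 0 < x -> 0 < y -> log2 (x / y) = log2 x - log2 y.
Proof. by move=> x0 y0; rewrite /log2 ln_div ?posrE // mulrBl. Qed.

Lemma log2_gt0 x : 0 < log2 x -> 1 < x.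
Proof.
rewrite [1 < x]ltNge; apply: contraTN => x1; rewrite -leNgt /log2 pmulr_lle0 ?invr_gt0 ?ln2_gt0 //.
exact: ln_le0.
Qed.

Lemma powR2_mono y y' : y <= y' -> 2 `^ y <= 2 `^ y' :> R.
Proof. by apply: ler_powR; rewrite ler1n. Qed.

Lemma powR_log2 x e : 0 < x -> x `^ e = 2 `^ (e * log2 x).
Proof. by move=> x0; rewrite -[in LHS](log2K x0) -powRrM mulrC. Qed.

(** [ln z < z] at [z = x ^ (e / 2)] bounds [log2 x] by a multiple of [x ^ (e / 2)]; a second such
    factor beats the constant. *)
Lemma log2_negligible (e K : R) : 0 < e -> 0 < K ->
  exists2 x0, 1 <= x0 & forall x, x0 <= x -> K * log2 x <= x `^ e.
Proof.
move=> e0 K0; pose M := K / ln 2 * (2 / e).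
have M0 : 0 < M by rewrite !mulr_gt0 ?invr_gt0 ?ln2_gt0.
exists (1 + M `^ (2 / e)); first by rewrite lerDl powR_ge0.
move=> x hx; have x0 : 0 < x by have := powR_ge0 M (2 / e); lra.
have xe0 : 0 < x `^ (e / 2) by rewrite powR_gt0.
have Mx : M <= x `^ (e / 2).
  have -> : M = (M `^ (2 / e)) `^ (e / 2).
    by rewrite -powRrM (_ : 2 / e * (e / 2) = 1) ?powRr1 ?ltW //; field; rewrite gt_eqF.
  rewrite ge0_ler_powR ?nnegrE ?powR_ge0 ?ltW ?divr_gt0 //.
  by have := powR_ge0 M (2 / e); lra.
have lnx : ln x <= 2 / e * x `^ (e / 2).
  have := ltW (ln_sublinear xe0); rewrite ln_powR => h.
  have e2 : 0 <= 2 / e by rewrite divr_ge0 // ltW.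
  have := ler_wpM2l e2 h; rewrite mulrA (_ : 2 / e * (e / 2) = 1) ?mul1r //.
  by field; rewrite gt_eqF.
apply: (@le_trans _ _ (M * x `^ (e / 2))).
  rewrite /log2 (_ : K * (ln x / ln 2) = K / ln 2 * ln x); last by ring.
  rewrite /M -[leRHS]mulrA; apply: ler_wpM2l lnx.
  by rewrite divr_ge0 // ltW // ln2_gt0.
rewrite (_ : x `^ e = x `^ (e / 2) * x `^ (e / 2)); first by rewrite ler_wpM2r // ltW.
by rewrite -powRD ?gt_eqF ?implybT // -splitr.
Qed.

End Log2.

(** As [T < 2 ^ T], the exponent [(T + 9) * T.+1 * 2 ^ T] is at most [9 * 8 ^ T]. The square in
    [l <= lg ^ 2] doubles the 9, and the factor 16 adds 4. *)
Lemma hard_threshold_le (R : realType) (lg : R) (k l T : nat) :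
  1 <= log2 lg -> 0 < lg -> l%:R <= lg ^+ 2 ->
  (hard_threshold (l ^ (k + 7)) T)%:R
    <= 2 `^ ((18 * (k + 7) + 4)%:R * (8 ^ T)%:R * log2 lg) :> R.
Proof.
move=> ll1 lg0 hl; set p := (8 ^ T)%N.
have p1 : 1 <= p%:R :> R by rewrite ler1n expn_gt0.
pose e := ((T + 9) * T.+1 * 2 ^ T)%N.
have he : (e <= 9 * p)%N.
  have h1 : (T < 2 ^ T)%N by apply: ltn_expl.
  have -> : (9 * p)%N = (9 * 2 ^ T * 2 ^ T * 2 ^ T)%N by rewrite /p -[8%N]/(2 * 2 * 2)%N !expnMn; lia.
  by rewrite leq_mul // leq_mul //; lia.
have -> : (hard_threshold (l ^ (k + 7)) T)%:R = 16 * l%:R ^+ ((k + 7) * e) :> R.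
  by rewrite /hard_threshold natrM -expnM natrX.
have hlp : l%:R <= 2 `^ (2 * log2 lg) :> R.
  by rewrite mulrC powRrM log2K // (powR_mulrn 2) // ltW.
have hpow : l%:R ^+ ((k + 7) * e) <= 2 `^ (2 * log2 lg * ((k + 7) * e)%:R) :> R.
  by rewrite powRrM powR_mulrn ?powR_ge0 // lerXn2r ?nnegrE ?powR_ge0.
have -> : 16 = 2 `^ 4 :> R by rewrite (powR_mulrn 4) //; ring.
apply: le_trans (ler_wpM2l (powR_ge0 _ _) hpow) _.
rewrite -powRD; last by rewrite (gt_eqF (ltr0Sn R 1)) implybT.
apply: powR2_mono.
have he' : ((k + 7) * e)%:R <= (k + 7)%:R * (9 * p%:R) :> R.
  by rewrite natrM ler_wpM2l // -natrM ler_nat.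
have ll2 : 0 <= 2 * log2 lg by lra.
have h1 := ler_wpM2l ll2 he'.
have h4 : 1 <= p%:R * log2 lg by rewrite -[leLHS]mulr1 ler_pM.
rewrite (natrD _ (18 * (k + 7))) (natrM _ 18); apply: (@le_trans _ _ (4 + 2 * log2 lg * ((k + 7)%:R * (9 * p%:R)))).
  by rewrite lerD2l.
rewrite (_ : (18%:R * (k + 7)%:R + 4%:R) * p%:R * log2 lg =
  4 * (p%:R * log2 lg) + 2 * log2 lg * ((k + 7)%:R * (9 * p%:R))); last by ring.
by rewrite lerD2r; lra.
Qed.

(** [X] is the bound to reach and [log2 Lambda] what the strings allow, up to the slack [A]. The 12
    in [c] is [3 * 2 * 2]: [8 = 2 ^ 3], [T <= 2 * (c * X)], and [8 ^ T] may use only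
    [Lambda ^ (delta / 2)]. *)
Lemma probe_parameter (R : realType) (delta lg Lambda X : R) (k l : nat) :
  let E : R := (18 * (k + 7) + 4)%:R in
  let A : R := (4 * k + 8)%:R in
  let c := delta / (12 * A * E) in
  0 < delta < 1 -> 1 <= log2 lg -> 0 < lg -> lg <= l%:R <= lg ^+ 2 ->
  E * log2 lg <= lg `^ (delta / 2) -> Lambda <= lg -> 1 < c * X -> X <= A * log2 Lambda ->
  exists T : nat, [/\ c * X <= T%:R,
    (hard_threshold (l ^ (k + 7)) T)%:R <= 2 `^ (Lambda * log2 lg) :> R,
    (hard_threshold (l ^ (k + 7)) T)%:R <= 2 `^ (lg `^ delta) :> R & (2 ^ T <= l)%N].
Proof.
move=> E A c /andP[d0 d1] ll1 lg0 /andP[lgl llg] hE hL cX hX.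
have E1 : 1 <= E by rewrite ler1n addn_gt0 orbT.
have A8 : 8 <= A by rewrite ler_nat leq_addl.
have E0 : 0 < E by lra.
have A0 : 0 < A by lra.
have AE0 : 0 < 12 * A * E by rewrite !mulr_gt0.
have c0 : 0 < c by rewrite divr_gt0.
set y := log2 Lambda in hX.
have cAE : c * A * (12 * E) = delta.
  have : A != 0 by rewrite gt_eqF.
  have : E != 0 by rewrite gt_eqF.
  by rewrite /c; clear; clearbody A E; move=> e0 a0; field; rewrite e0 a0.
have cAy : 1 < c * A * y by apply: lt_le_trans cX _; rewrite -mulrA ler_pM2l.
(* The smallness of [c] turns [1 < c * X] into a lower bound on [y], which puts [E] below the square
   root of [Lambda]. *)
have y12 : 12 * E < y.
  have : 12 * E * 1 < 12 * E * (c * A * y) by rewrite ltr_pM2l // mulr_gt0.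
  have y0 : 0 < y by have := lt_trans ltr01 cAy; rewrite pmulr_rgt0 // mulr_gt0.
  by rewrite [X in _ < X]mulrA [12 * E * (c * A)]mulrC cAE; nra.
have y0 : 0 < y by lra.
have L1 := log2_gt0 y0; have L0 : 0 < Lambda by lra.
have LE : 2 `^ y = Lambda by rewrite log2K.
have cA6 : 6 * (c * A) * y <= delta / 2 * y.
  rewrite ler_pM2r //; have cA0 : 0 < c * A by rewrite mulr_gt0.
  by have := ler_wpM2l (ltW cA0) E1; lra.
have cX0 : 0 <= 2 * (c * X) by lra.
(* Rounding [2 * (c * X)] down loses less than 1, hence less than [c * X]. *)
exists (Num.truncn (2 * (c * X))); set T := Num.truncn _.
have /andP[Tle Tgt] := truncn_itv cX0; rewrite -/T in Tle Tgt.
have hp : (8 ^ T)%:R <= 2 `^ (delta / 2 * y) :> R.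
  rewrite (_ : (8 ^ T)%:R = 2 `^ (3 * T%:R) :> R); last first.
    by rewrite powRrM (powR_mulrn 3) // powR_mulrn ?exprn_ge0 // natrX; congr (_ ^+ _); ring.
  apply: powR2_mono; apply: le_trans cA6.
  have : c * X <= c * A * y by rewrite -mulrA ler_pM2l.
  by lra.
have hp2 : (8 ^ T)%:R <= 2 `^ (y / 2) :> R.
  by apply: le_trans hp (powR2_mono _); nra.
have EL : E <= 2 `^ (y / 2).
  apply: (@le_trans _ _ (2 `^ E)); last by apply: powR2_mono; lra.
  by rewrite powR_mulrn // -natrX ler_nat ltnW // ltn_expl.
have LL : 2 `^ (y / 2) * 2 `^ (y / 2) = Lambda.
  by rewrite -powRD -?splitr // (gt_eqF (ltr0Sn R 1)) implybT.
have h8 : 1 <= (8 ^ T)%:R :> R by rewrite ler1n expn_gt0.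
have hpL : (8 ^ T)%:R <= Lambda.
  rewrite -LL; apply: le_trans hp2 _; rewrite ler_peMr ?powR_ge0 //.
  exact: le_trans EL.
have hF := hard_threshold_le k T ll1 lg0 llg.
split.
- by have := Tgt; rewrite -addn1 natrD => ?; lra.
- apply: le_trans hF (powR2_mono _); rewrite ler_wpM2r //; first by lra.
  by rewrite -LL ler_pM // ltW.
- apply: le_trans hF (powR2_mono _); rewrite mulrAC.
  rewrite (_ : lg `^ delta = lg `^ (delta / 2) * lg `^ (delta / 2)); last first.
    by rewrite -powRD -?splitr // (gt_eqF lg0) implybT.
  apply: ler_pM => //; first by rewrite mulr_ge0 ?ltW //; lra.
  apply: le_trans hp _; rewrite [delta / 2 * y]mulrC (powRrM 2 y) LE.
  by apply: ge0_ler_powR; rewrite ?nnegrE //; lra.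
- rewrite -(ler_nat R); apply: le_trans lgl; apply: le_trans hL; apply: le_trans hpL.
  by rewrite ler_nat; case: (T) => // e; rewrite leq_exp2r.
Qed.

(** Origin of the exponent of [b]: the word-size condition is of order [l ^ 3], and
    [512 * 64 ^ T <= l * l ^ 6]; the summand [k] is for the redundancy in space. *)
Lemma log_parameters_le (k l w T : nat) : (512 <= l)%N -> (w <= l ^ 2)%N -> (2 ^ T <= l)%N ->
  (2 + (w + 2 * l).+1 + 4 * (w + 2 * l).+1 * (2 * l).+1 <= l ^ (k + 7))%N /\
  (512 * 64 ^ T <= l ^ (k + 7))%N.
Proof.
move=> hl hw hT; have l0 : (0 < l)%N by lia.
have e4 : (l ^ 4 <= l ^ (k + 7))%N by rewrite leq_pexp2l //; lia.
have e7 : (l ^ 7 <= l ^ (k + 7))%N by rewrite leq_pexp2l //; lia.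
split; [apply: leq_trans e4|apply: leq_trans e7].
  have hw' : ((w + 2 * l).+1 <= 2 * l ^ 2)%N.
    by rewrite -mulnn in hw *; nia.
  have h1 : (4 * (w + 2 * l).+1 * (2 * l).+1 <= 4 * (2 * l ^ 2) * (3 * l))%N.
    by rewrite leq_mul // ?leq_mul //; lia.
  have h2 : (2 + 2 * l ^ 2 + 4 * (2 * l ^ 2) * (3 * l) <= l ^ 4)%N.
    have -> : (l ^ 4 = l * (l * l ^ 2))%N by rewrite -!expnS.
    have : (1 <= l ^ 2)%N by rewrite expn_gt0 l0.
    have : (l ^ 2 <= l * l ^ 2)%N by rewrite leq_pmull.
    have : (512 * (l * l ^ 2) <= l * (l * l ^ 2))%N by rewrite leq_mul2r hl orbT.
    by rewrite [(_ * (3 * l))%N]mulnC -mulnA; move: (l ^ 2)%N => x; lia.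
  lia.
rewrite [(l ^ 7)%N]expnS leq_mul // (_ : 64 = 2 ^ 6)%N // -expnM mulnC expnM.
by rewrite leq_exp2r.
Qed.

(** Since [r.-1./2] is at least [r / 4], the space per run bounds the bits of a letter by about
    [4 * l ^ k.+1]. *)
Lemma alphabet_bound (k l n s r S w : nat) : (6 <= l)%N -> (n <= 2 ^ l)%N -> (3 <= r)%N ->
  (S * w <= r * l ^ k.+1)%N -> (s.+1 ^ (r.-1./2) <= 2 ^ (S * w))%N ->
  (n * s.+2 <= 2 ^ (l ^ k.+2))%N.
Proof.
move=> l6 hn r3 hS hs; set m := (r.-1./2)%N in hs.
have mr : (r <= 4 * m)%N by have := odd_double_half r.-1; rewrite /m; lia.
have m0 : (0 < m)%N by lia.
have /andP[hj1 hj2] := trunc_log_bounds (isT : (1 < 2)%N) (isT : (0 < s.+1)%N).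
set j := trunc_log 2 s.+1 in hj1 hj2.
have hj : (j <= 4 * l ^ k.+1)%N.
  rewrite -(leq_pmul2r m0) -(leq_exp2l _ _ (isT : (1 < 2)%N)) expnM.
  apply: leq_trans (_ : s.+1 ^ m <= _)%N; first by rewrite leq_exp2r.
  apply: leq_trans hs _; rewrite leq_exp2l //; apply: leq_trans hS _.
  by have := leq_mul mr (leqnn (l ^ k.+1)); lia.
have l1 : (1 <= l ^ k.+1)%N by rewrite expn_gt0; apply/orP; left; lia.
have ll : (l <= l ^ k.+1)%N by rewrite expnS leq_pmulr // expn_gt0; apply/orP; left; lia.
apply: (@leq_trans (2 ^ l * 2 ^ j.+1)); first by rewrite leq_mul.
rewrite -expnD leq_exp2l // expnS.
have : (6 * l ^ k.+1 <= l * l ^ k.+1)%N by rewrite leq_mul2r l6 orbT.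
by lia.
Qed.

Theorem theorem4 (R : realType) (delta : R) (hdelta : 0 < delta < 1)
    (w1 w2 : R) (hw1 : 0 < w1) (hw2 : 0 < w2)
    (C : R) (hC : 0 < C) (k : nat) :
  exists2 c : R, 0 < c &
  exists n0 : nat,
  forall (n sigma r w S : nat),
    (n0 <= n)%N ->
    (* together with the lower bound on r: some string has r runs *)
    (2 <= sigma)%N -> (r <= n)%N ->
    2 `^ (log2 n%:R `^ delta) <= r%:R :> R ->
    w1 * log2 n%:R <= w%:R <= w2 * log2 n%:R ->
    (S * w)%:R <= C * r%:R * log2 n%:R ^+ k ->
    [/\ forall D : data_structure w S (@rank_problem n sigma r),
          exists (B : run_string n sigma r) (q : 'I_sigma * 'I_n),
            c * log2 (log2 ((n * sigma)%:R / r%:R) / log2 (log2 n%:R))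
              <= (query_time D B q)%:R,
        forall D : data_structure w S (@select_problem n sigma r),
          exists (B : run_string n sigma r) (q : 'I_sigma * int),
            c * log2 (log2 (n%:R / r%:R) / log2 (log2 n%:R))
              <= (query_time D B q)%:R
      & forall D : data_structure w S (@access_problem n sigma r),
          exists (B : run_string n sigma r) (i : 'I_n),
            c * log2 (log2 (n%:R / r%:R) / log2 (log2 n%:R))
              <= (query_time D B i)%:R].
Proof.
pose E : R := (18 * (k + 7) + 4)%:R; pose A : R := (4 * k + 8)%:R.
have [d0 d1] := andP hdelta.
have E1 : 1 <= E by rewrite ler1n addn_gt0 orbT.
have A8 : 8 <= A by rewrite ler_nat leq_addl.
have AE0 : 0 < 12 * A * E by rewrite !mulr_gt0 //; lra.
pose c := delta / (12 * A * E).
have c0 : 0 < c by rewrite divr_gt0.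
have c1 : 2 * c < 1.
  by rewrite /c mulrA ltr_pdivrMr // mul1r; nra.
have [|x1 x11 hx1] := @log2_negligible R (delta / 2) E _ (lt_le_trans ltr01 E1); first lra.
have [|x2 x21 hx2] := @log2_negligible R (1 / 2) 1 _ ltr01; first lra.
(* Beyond [L0], [log2 n] dominates [w2] and [C], each of which then costs one power of [l], and
   exceeds both thresholds of [log2_negligible]. *)
pose L0 := 512 + w2 + C + x1 + x2.
exists c => //; exists (Num.truncn (2 `^ L0)).+1 => n sigma r w S hn hsigma rn hr /andP[hw1' hw2'] hS.
have n2 : 2 `^ L0 <= n%:R.
  by apply: le_trans (ltW (truncnS_gt _)) _; rewrite ler_nat.
have L00 : 512 <= L0 by rewrite /L0; lra.
have n0 : 0 < n%:R :> R by apply: lt_le_trans n2; rewrite powR_gt0.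
set lg := log2 n%:R in hr hw1' hw2' hS *.
have lgL : L0 <= lg by rewrite -[L0]powR2K ler_log2 // powR_gt0.
have lg0 : 0 < lg by lra.
have ll1 : 1 <= log2 lg.
  rewrite -[leLHS]powR2K ler_log2 ?powR_gt0 // powRr1 //; lra.
set ll := log2 lg in ll1 *.
have hE : E * ll <= lg `^ (delta / 2) by apply: hx1; rewrite /L0 in lgL; lra.
have hll : 1 * ll <= lg `^ (1 / 2) by apply: hx2; rewrite /L0 in lgL; lra.
pose l := up_log 2 n.
have nl : (n <= 2 ^ l)%N by apply: up_logP.
have lgl : lg <= l%:R.
  rewrite -[l%:R]powR2K ler_log2 // powR_mulrn // -natrX ler_nat //.
have n1 : (1 < n)%N.
  rewrite -(ltr_nat R); apply: lt_le_trans n2; apply: (@lt_le_trans _ _ 2); first by rewrite ltr1n.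
  by rewrite -[leLHS]powRr1 //; apply: powR2_mono; lra.
have lle : l%:R <= lg + 1.
  have := up_log_gtn (isT : (1 < 2)%N) n1; rewrite -/l => h.
  have : (l.-1)%:R <= lg.
    rewrite -[leLHS]powR2K ler_log2 ?powR_gt0 // powR_mulrn // -natrX ler_nat //.
    exact: ltnW.
  have : (l <= l.-1 + 1)%N by rewrite addn1 leqSpred.
  by rewrite -(ler_nat R) natrD; lra.
have llg : l%:R <= lg ^+ 2 by apply: le_trans lle _; rewrite expr2; clear -L00 lgL; nra.
have l512 : (512 <= l)%N by rewrite -(ler_nat R); clear -L00 lgL lgl; lra.
have l0 : (0 < l)%N by apply: leq_trans l512.
have wl : (w <= l ^ 2)%N.
  rewrite -(ler_nat R) natrX; apply: le_trans hw2' _.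
  by rewrite expr2 ler_pM ?(ltW lg0) ?(ltW hw2) //; clear -hw2 hC lgL lgl x11 x21; rewrite /L0 in lgL; lra.
have w0 : (0 < w)%N.
  by rewrite -(ltr_nat R); apply: lt_le_trans hw1'; rewrite mulr_gt0.
have SwB : (S * w <= r * l ^ k.+1)%N.
  rewrite -(ler_nat R); apply: le_trans hS _.
  rewrite natrM natrX exprS [C * _]mulrC -mulrA ler_wpM2l // ler_pM ?exprn_ge0 ?(ltW hC) ?(ltW lg0) //.
    by rewrite /L0 in lgL; lra.
  by rewrite lerXn2r ?nnegrE // ltW.
pose b := (l ^ (k + 7))%N.
have SB : (S <= r * b)%N.
  apply: leq_trans (leq_pmulr _ w0) (leq_trans SwB _).
  by rewrite leq_mul2l leq_pexp2l ?orbT //; clear; lia.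
have nn : (n * n <= 2 ^ (2 * l))%N by rewrite mul2n -addnn expnD leq_mul.
have E2 : 2 <= E by rewrite ler_nat; clear; lia.
have lgd2 : 2 <= lg `^ delta.
  apply: (@le_trans _ _ (lg `^ (delta / 2))); last by apply: ler_powR; clear -d0 lgL L00; lra.
  by apply: le_trans hE; rewrite -[leLHS]mulr1 ler_pM.
have r3 : (3 <= r)%N.
  rewrite -(ler_nat R); apply: le_trans hr; apply: (@le_trans _ _ (2 `^ 2)); last exact: powR2_mono.
  by rewrite (powR_mulrn 2) // -natrX ler_nat.
have r0 : 0 < r%:R :> R by rewrite ltr0n (leq_trans _ r3).
have n_r0 : 0 < n%:R / r%:R :> R by rewrite divr_gt0.
case: sigma hsigma => [//|[//|sigma]] _.
have thrr T : (hard_threshold b T)%:R <= 2 `^ (lg `^ delta) :> R -> (hard_threshold b T <= r)%N.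
  by move=> h; rewrite -(ler_nat R); apply: le_trans hr.
have thrn T : (hard_threshold b T)%:R <= n%:R / r%:R :> R -> (hard_threshold b T * r <= n)%N.
  by rewrite ler_pdivlMr // -natrM ler_nat.
have ll0 : 0 < ll by clear -ll1; lra.
have div_ll x : 0 < x -> x <= n%:R -> log2 x / ll <= lg.
  move=> x0 xn; rewrite ler_pdivrMr //; apply: le_trans (ler_log2 x0 xn) _.
  by rewrite -[leLHS]mulr1 ler_pM2l.
have nr_n : n%:R / r%:R <= n%:R :> R by rewrite ler_pdivrMr // ler_peMr ?(ltW n0) // ler1n (leq_trans _ r3).
have r2 : (2 <= r)%N by apply: leq_trans r3.
have hlgl : lg <= l%:R <= lg ^+ 2 by rewrite lgl llg.
(* To be used with [x] equal to [n / r], to the larger of [n / r] and the alphabet size, or to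
   [n]. *)
have param x X : 0 < x -> x <= n%:R -> 1 < c * X -> X <= A * log2 (log2 x / ll) ->
    exists T : nat, [/\ c * X <= T%:R, (hard_threshold b T)%:R <= x,
      (hard_threshold b T <= r)%N & (2 ^ T <= l)%N].
  move=> x0 xn cX hX.
  have [T []] := probe_parameter hdelta ll1 lg0 hlgl hE (div_ll x x0 xn) cX hX.
  rewrite divfK ?gt_eqF // log2K // => h1 h2 /thrr h3 h4.
  by exists T.
have mono T : (2 ^ T <= l)%N -> (2 + w.+1 + 4 * w.+1 * (2 * l).+1 <= b)%N.
  move=> /(log_parameters_le k l512 wl)[h _]; apply: leq_trans h.
  by rewrite leq_add // ?leq_add ?leq_mul // ltnS leq_addr.
set X := log2 (log2 (n%:R / r%:R) / ll).
have small : 1 < c * X -> exists T : nat, [/\ c * X <= T%:R, (hard_threshold b T <= r)%N,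
    (hard_threshold b T * r <= n)%N & (2 ^ T <= l)%N].
  move=> cX; have X0 : 0 < X by rewrite -(pmulr_rgt0 _ c0); apply: lt_trans cX.
  have [|T [h1 /thrn h2 h3 h4]] := param _ X n_r0 nr_n cX; last by exists T.
  by rewrite -/X; clear -A8 X0; nra.
split=> D.
- set Y := log2 (log2 ((n * sigma.+2)%:R / r%:R) / ll).
  have [cY|cY] := leP (c * Y) 1.
    have [B [q hq]] := rank_probing_query r2 rn D; exists B, q.
    by apply: le_trans cY _; rewrite ler1n.
  have Y2 : 2 < Y.
    by rewrite -(ltr_pM2l c0); apply: lt_trans cY; rewrite mulrC.
  have num0 : 0 < (n * sigma.+2)%:R / r%:R :> R by rewrite divr_gt0 // natrM mulr_gt0.
  have L1 := log2_gt0 (lt_trans (ltr0Sn R 1) Y2).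
  have LY : log2 (log2 ((n * sigma.+2)%:R / r%:R) / ll) = Y by [].
  move: L1 LY; set L := _ / ll => L1 LY; have L0' : 0 < L by clear -L1; lra.
  suff [T [h1 h2 h3 h4]] : exists T : nat, [/\ c * Y <= T%:R, (hard_threshold b T <= r)%N,
      (hard_threshold b T * r <= n)%N || (hard_threshold b T <= sigma.+2)%N & (2 ^ T <= l)%N].
    have [b1 b2] := log_parameters_le k l512 wl h4.
    suff [B [q hq]] : exists B q, (T <= query_time D B q)%N.
      by exists B, q; apply: le_trans h1 _; rewrite ler_nat.
    case/orP: h3 => h3; first exact: binary_rank_slow_query h2 h3 nn SB (mono _ h4) b2 D.
    exact: rank_slow_query h2 h3 rn nn SB b1 b2.
  (* If the alphabet has at most [n] letters, [n * sigma.+2 / r] is at most the square of the larger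
     of [n / r] and [sigma.+2], so one of the two rank constructions applies. The square adds 1 in
     [hY], harmless as [2 < Y]. *)
  have [sn|ns] := leqP sigma.+2 n.
    pose M := Num.max (n%:R / r%:R) sigma.+2%:R : R.
    have M0 : 0 < M by rewrite lt_max n_r0.
    have Mn : M <= n%:R by rewrite ge_max nr_n ler_nat.
    have LM : L <= 2 * (log2 M / ll).
      rewrite mulrA ler_pM2r ?invr_gt0 // natrM mulrAC log2M //.
      have h1 : log2 (n%:R / r%:R) <= log2 M by rewrite ler_log2 // le_max lexx.
      have h2 : log2 sigma.+2%:R <= log2 M by rewrite ler_log2 // le_max lexx orbT.
      by clear -h1 h2; lra.
    have LM0 : 0 < log2 M / ll by clear -LM L0'; lra.
    have hY : Y <= 1 + log2 (log2 M / ll).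
      rewrite -LY; apply: le_trans (ler_log2 L0' LM) _; rewrite log2M // lerD2r.
      by rewrite -[X in log2 X](@powRr1 R 2) // powR2K.
    have [|T [h1 h2 h3 h4]] := param M Y M0 Mn cY; first by clear -Y2 hY A8; nra.
    exists T; split=> //; move: h2; rewrite le_max => /orP[/thrn ->//|].
    by rewrite ler_nat => ->; rewrite orbT.
  (* A larger alphabet is limited by the space: [Y] is at most a multiple of [log log n], and the
     large-alphabet construction with threshold at most [n] suffices. This case dictates
     [A = 2 * (2 * k + 4)]. *)
  have hsp : (n * sigma.+2 <= 2 ^ (l ^ k.+2))%N.
    apply: (alphabet_bound _ nl r3 SwB); first by apply: leq_trans l512.
    by apply: rank_space_bound D _ rn; apply: leq_trans r3.
  have hL : L <= lg `^ (2 * k.+2%:R).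
    rewrite ler_pdivrMr //; apply: (@le_trans _ _ (lg `^ (2 * k.+2%:R))); last first.
      by rewrite ler_peMr ?powR_ge0.
    rewrite powRrM powR_mulrn ?powR_ge0 // (powR_mulrn 2) ?(ltW lg0) //.
    apply: (@le_trans _ _ (l%:R ^+ k.+2)); last by rewrite lerXn2r ?nnegrE ?exprn_ge0 // ltW.
    rewrite -natrX -[leRHS]powR2K ler_log2 // powR_mulrn // -natrX.
    apply: (@le_trans _ _ (n * sigma.+2)%:R); last by rewrite ler_nat.
    by rewrite ler_pdivrMr // ler_peMr // ler1n (leq_trans _ r3).
  have hY : Y <= (2 * k + 4)%:R * ll.
    rewrite -LY; apply: le_trans (ler_log2 L0' hL) _.
    rewrite (powR_log2 _ lg0) powR2K -/ll (_ : 2 * k.+2%:R = (2 * k + 4)%:R :> R) //.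
    by rewrite -natrM; congr (_%:R); clear; lia.
  have half : ll / 2 <= log2 (lg / ll).
    rewrite log2_div // -/ll.
    have : log2 ll <= log2 (lg `^ (1 / 2)) by apply: ler_log2 => //; clear -hll; lra.
    by rewrite (powR_log2 _ lg0) powR2K -/ll; clear; lra.
  have [|T [h1 h2 h3 h4]] := param n%:R Y n0 (lexx _) cY.
    apply: le_trans hY _; rewrite -/lg; apply: (@le_trans _ _ (A * (ll / 2))).
      rewrite (_ : A = 2 * (2 * k + 4)%:R :> R); first by clear; lra.
      by rewrite /A -natrM; congr (_%:R); clear; lia.
    by rewrite ler_pM2l // (lt_le_trans _ A8).
  exists T; split=> //; apply/orP; right; apply: ltnW; apply: leq_ltn_trans ns.
  by rewrite -(ler_nat R).
- have [cX|/small[T [h1 h2 h3 h4]]] := leP (c * X) 1.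
    have [B [q hq]] := select_probing_query r2 rn D; exists B, q.
    by apply: le_trans cX _; rewrite ler1n.
  have [B [q hq]] := select_slow_query h2 h3 nn SB (mono _ h4)
    (log_parameters_le k l512 wl h4).2 D.
  by exists B, q; apply: le_trans h1 _; rewrite ler_nat.
- have [cX|/small[T [h1 h2 h3 h4]]] := leP (c * X) 1.
    have [B [q hq]] := access_probing_query r2 rn D; exists B, q.
    by apply: le_trans cX _; rewrite ler1n.
  have [B [q hq]] := access_slow_query h2 h3 nn SB (mono _ h4)
    (log_parameters_le k l512 wl h4).2 D.
  by exists B, q; apply: le_trans h1 _; rewrite ler_nat.
Qed.
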